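(* Let $1<p<q<\infty$ and let $A,B\in\mathcal L(\ell_p,\ell_q)$. Then the multiplication operator $L_AR_B\colon\mathcal L(\ell_q,\ell_p)\rightarrow\mathcal L(\ell_p,\ell_q)$, $L_AR_B(T)=ATB$, is strictly singular.
   Context: $\mathcal L(X,Y)$ denotes the Banach space of bounded linear operators from $X$ to $Y$ with the operator norm. A bounded operator $S\colon E\to F$ between Banach spaces is strictly singular if for every infinite-dimensional subspace $E_0\subseteq E$ the restriction $S|_{E_0}$ is not an isomorphism onto its range; equivalently, for every infinite-dimensional subspace $E_0\subseteq E$ and every $\varepsilon>0$ there is a nonzero $x\in E_0$ with $\|Sx\|\leq\varepsilon\|x\|$. *)

(* Defs.v *)
From HB Require Import structures.
From mathcomp Require Import all_boot all_order all_algebra.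
From mathcomp Require Import all_classical all_reals all_analysis.
From mathcomp Require Import complex.

Set Implicit Arguments.
Unset Strict Implicit.
Unset Printing Implicit Defensive.

Import Order.TTheory GRing.Theory Num.Theory.
Import numFieldNormedType.Exports.

Local Open Scope classical_set_scope.
Local Open Scope ring_scope.

(* Banach spaces may be taken over the reals or over the complex numbers. A
   norm of the library on a space over K takes its values in K itself, so real
   quantities are embedded in K by of_real. *)
Variant scalars := RealScalars | ComplexScalars.

Definition scalar_field (R : realType) (k : scalars) : numFieldType :=
  match k with RealScalars => R | ComplexScalars => R[i] end.

Definition modulus (R : realType) (k : scalars) : scalar_field R k -> R :=
  match k with
  | RealScalars => fun x : R => `|x|
  | ComplexScalars => fun z : R[i] => ComplexField.Normc.normc z
  end.

Definition of_real (R : realType) (k : scalars) : R -> scalar_field R k :=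
  match k with
  | RealScalars => fun x : R => x
  | ComplexScalars => fun x : R => x%:C%C
  end.
Arguments of_real {R} k.

Section Scalars.
Variables (R : realType) (k : scalars).
Implicit Types (x y : scalar_field R k) (a b : R).

Lemma norm_modulus x : `|x| = of_real k (modulus x).
Proof. by case: k x => //= -[a b]. Qed.

Lemma of_realM a b : of_real k (a * b) = of_real k a * of_real k b.
Proof. by case: k => //=; exact: rmorphM. Qed.

Lemma of_realD a b : of_real k (a + b) = of_real k a + of_real k b.
Proof. by case: k => //=; exact: rmorphD. Qed.

Lemma of_real0 : of_real k (0 : R) = 0.
Proof. by case: k. Qed.

Lemma of_real1 : of_real k (1 : R) = 1.
Proof. by case: k. Qed.

Lemma ler_of_real a b : (of_real k a <= of_real k b) = (a <= b).
Proof. by case: k => //=; rewrite lecR. Qed.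

Lemma of_real_inj : injective (@of_real R k).
Proof. by move=> a b /eqP; rewrite eq_le !ler_of_real -eq_le => /eqP. Qed.

Lemma modulus_ge0 x : 0 <= modulus x.
Proof. by rewrite -ler_of_real of_real0 -norm_modulus. Qed.

Lemma modulus0 : modulus (0 : scalar_field R k) = 0.
Proof. by apply: of_real_inj; rewrite -norm_modulus normr0 of_real0. Qed.

Lemma modulus_eq0 x : modulus x = 0 -> x = 0.
Proof. by move=> x0; apply/normr0_eq0; rewrite norm_modulus x0 of_real0. Qed.

Lemma modulusM x y : modulus (x * y) = modulus x * modulus y.
Proof. by apply: of_real_inj; rewrite of_realM -!norm_modulus normrM. Qed.

Lemma ler_modulusD x y : modulus (x + y) <= modulus x + modulus y.
Proof. by rewrite -ler_of_real of_realD -!norm_modulus ler_normD. Qed.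

Lemma of_real_modulus_norm (V : normedModType (scalar_field R k)) (v : V) :
  of_real k (modulus `|v|) = `|v|.
Proof. by rewrite -norm_modulus normr_id. Qed.

End Scalars.

Section Lp.
Variables (R : realType) (k : scalars) (p : R) (p1 : 1 <= p).
Local Notation K := (scalar_field R k).

Definition lp_norm (x : nat -> K) : \bar R :=
  'N[counting]_(p%:E)[EFin \o (@modulus R k \o x)]%E.

(* p1 is kept as an argument so that the instances below can infer it *)
Definition lp_pred of 1 <= p : {pred nat -> K} := fun x => `[< (lp_norm x < +oo)%E >].

Let p_gt0 : 0 < p. Proof. exact: lt_le_trans p1. Qed.

Let term_ge0 (x : nat -> K) n : (0 <= ((modulus (x n)) `^ p)%:E)%E.
Proof. by rewrite lee_fin powR_ge0. Qed.

Let sum_ge0 (x : nat -> K) :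
  (0 <= \sum_(0 <= n <oo) ((modulus (x n)) `^ p)%:E)%E.
Proof. by apply: nneseries_ge0 => *; exact: term_ge0. Qed.

Lemma lp_normE (x : nat -> K) :
  (lp_norm x = (\sum_(0 <= n <oo) ((modulus (x n)) `^ p)%:E) `^ p^-1)%E.
Proof.
rewrite /lp_norm Lnorm_counting//; congr (_ `^ _)%E.
by apply: eq_eseriesr => n _ /=; rewrite ger0_norm ?modulus_ge0.
Qed.

Lemma lp_norm_ge0 (x : nat -> K) : (0 <= lp_norm x)%E.
Proof. exact: Lnorm_ge0. Qed.

Lemma lp_normD (x y : nat -> K) :
  (lp_norm (x + y)%R <= lp_norm x + lp_norm y)%E.
Proof.
have mN (f : nat -> R) : measurable_fun [set: nat] f by [].
apply: le_trans (minkowski_EFin counting (mN _) (mN _) p1).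
rewrite lp_normE Lnorm_counting//; apply: gt0_ler_poweR.
- by rewrite invr_ge0 ltW.
- by rewrite in_itv/= leey andbT; exact: sum_ge0.
- rewrite in_itv/= leey andbT.
  by apply: nneseries_ge0 => *; rewrite lee_fin powR_ge0.
apply: lee_nneseries => [n _ _|n _]; first exact: term_ge0.
rewrite lee_fin ge0_ler_powR ?nnegrE// ?(ltW p_gt0)// ?modulus_ge0//.
rewrite ger0_norm ?addr_ge0 ?modulus_ge0//; exact: ler_modulusD.
Qed.

Lemma lp_normZ (a : K) (x : nat -> K) :
  lp_norm (a *: x) = ((modulus a)%:E * lp_norm x)%E.
Proof.
rewrite !lp_normE.
under eq_eseriesr do rewrite modulusM powRM ?modulus_ge0// EFinM.
rewrite nneseriesZl; last by move=> *; exact: term_ge0.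
rewrite poweRM ?lee_fin ?powR_ge0//.
by rewrite poweR_EFin -powRrM mulfV ?gt_eqF// powRr1 ?modulus_ge0.
Qed.

Lemma lp_submod_closed : submod_closed (lp_pred p1).
Proof.
split.
  apply/asboolP; suff -> : lp_norm 0 = 0%E by [].
  by rewrite -[0 in LHS](scale0r 0) lp_normZ modulus0 mul0e.
move=> a x y /asboolP xoo /asboolP yoo; apply/asboolP.
apply: le_lt_trans (lp_normD _ _) _.
by rewrite lp_normZ lte_add_pinfty// lte_mul_pinfty ?lee_fin ?modulus_ge0.
Qed.

HB.instance Definition _ := GRing.isSubmodClosed.Build _ _ (lp_pred p1)
  lp_submod_closed.

Record lp := Lp { lp_val :> nat -> K; lp_valP : lp_val \in lp_pred p1 }.

HB.instance Definition _ := [isSub for lp_val].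
HB.instance Definition _ := [Choice of lp by <:].
HB.instance Definition _ := [SubChoice_isSubLmodule of lp by <:].

Definition lp_nrm (x : lp) : K := of_real k (fine (lp_norm x)).

Lemma lp_norm_fin (x : lp) : lp_norm x \is a fin_num.
Proof. by rewrite ge0_fin_numE ?lp_norm_ge0//; exact/asboolP/lp_valP. Qed.

Lemma lp_nrmD (x y : lp) : lp_nrm (x + y) <= lp_nrm x + lp_nrm y.
Proof.
rewrite -of_realD ler_of_real -fineD ?lp_norm_fin// fine_le ?lp_normD//.
  exact: lp_norm_fin.
by rewrite fin_numD !lp_norm_fin.
Qed.

Lemma lp_nrmZ (a : K) (x : lp) : lp_nrm (a *: x) = `|a| * lp_nrm x.
Proof.
by rewrite /lp_nrm lp_normZ fineM ?lp_norm_fin// of_realM -norm_modulus.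
Qed.

Lemma lp_nrm_eq0 (x : lp) : lp_nrm x = 0 -> x = 0.
Proof.
rewrite /lp_nrm -(of_real0 R k) => /of_real_inj x0.
have {x0} : lp_norm x = 0%E by rewrite -(fineK (lp_norm_fin x)) x0.
rewrite lp_normE => /(poweR_eq0_eq0 (sum_ge0 x)) H.
apply/val_inj/funext => n; apply/modulus_eq0.
have : (((modulus (x n)) `^ p)%:E <= 0)%E.
  rewrite -H (@nneseriesD1 _ _ n)//.
  by rewrite leeDl//; apply: nneseries_ge0 => *; exact: term_ge0.
rewrite lee_fin => le0; apply: (@powR_eq0_eq0 _ _ p).
by apply/eqP; rewrite eq_le le0 powR_ge0.
Qed.

HB.instance Definition _ :=
  Lmodule_isNormed.Build K lp lp_nrmD lp_nrmZ lp_nrm_eq0.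

End Lp.
Arguments lp {R} k {p} p1.

Section BoundedOperators.
Variables (R : realType) (k : scalars).
Local Notation K := (scalar_field R k).
Variables E F : normedModType K.

Definition bounded_pred : {pred E -> F} :=
  fun f => `[< linear f /\ exists M : K, forall x, `|f x| <= M * `|x| >].

Lemma bounded_submod_closed : submod_closed bounded_pred.
Proof.
split.
  apply/asboolP; split; first by move=> a x y; rewrite scaler0 addr0.
  by exists 0 => x; rewrite [`|_|]normr0 mul0r.
move=> a f g /asboolP[lf [M fM]] /asboolP[lg [N gN]]; apply/asboolP.
have fgE x : (a *: f + g) x = a *: f x + g x by [].
split.
  by move=> b x y; rewrite !fgE lf lg !scalerDr !scalerA (mulrC a b) addrACA.
exists (`|a| * M + N) => x.
rewrite fgE mulrDl (le_trans (ler_normD _ _))// lerD//.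
by rewrite normrZ -mulrA ler_wpM2l.
Qed.

HB.instance Definition _ := GRing.isSubmodClosed.Build _ _ bounded_pred
  bounded_submod_closed.

Record bop := Bop { bop_val :> E -> F; bop_valP : bop_val \in bounded_pred }.

HB.instance Definition _ := [isSub for bop_val].
HB.instance Definition _ := [Choice of bop by <:].
HB.instance Definition _ := [SubChoice_isSubLmodule of bop by <:].

Lemma bop_linear (T : bop) : linear T.
Proof. by have /asboolP[] := bop_valP T. Qed.

HB.instance Definition _ (T : bop) :=
  GRing.isLinear.Build K E F _ T (bop_linear T).

Lemma bopP (S T : bop) : S =1 T -> S = T.
Proof. by move=> ST; exact/val_inj/funext. Qed.

Definition opnorm (T : bop) : R :=
  sup [set modulus `|T x| | x in [set x | `|x| <= 1]].

Lemma has_sup_opnorm (T : bop) :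
  has_sup [set modulus `|T x| | x in [set x | `|x| <= 1]].
Proof.
split; first by exists (modulus `|T 0|), 0 => //=; rewrite normr0.
have /asboolP[_ [M TM]] := bop_valP T.
exists (modulus M) => _ [x /= x1 <-].
rewrite -(ler_of_real k) of_real_modulus_norm -norm_modulus.
apply: (le_trans (real_ler_norm _)); first exact: normr_real.
rewrite normr_id (le_trans (TM x))//.
have [->|x0] := eqVneq x 0; first by rewrite normr0 mulr0.
have M0 : 0 <= M.
  by rewrite -(pmulr_lge0 _ (_ : 0 < `|x|)) ?normr_gt0// (le_trans _ (TM x)).
by rewrite (ger0_norm M0) ler_piMr.
Qed.

Lemma le_opnorm (T : bop) x : `|T x| <= of_real k (opnorm T) * `|x|.
Proof.
have [->|x0] := eqVneq x 0; first by rewrite linear0 !normr0 mulr0.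
have nx : 0 < `|x| by rewrite normr_gt0.
rewrite -ler_pdivrMr// mulrC -(normr_id x) -normfV -normrZ -linearZ.
rewrite -[leLHS]of_real_modulus_norm ler_of_real.
apply: ub_le_sup; first by have [] := has_sup_opnorm T.
by exists (`|x|^-1 *: x) => //=; rewrite normrZ normfV normr_id mulVf ?gt_eqF.
Qed.

Lemma opnorm_le (T : bop) (c : R) :
  (forall x, `|x| <= 1 -> `|T x| <= of_real k c) -> opnorm T <= c.
Proof.
move=> Tc; apply: ge_sup; first by have [] := has_sup_opnorm T.
by move=> _ [x /= x1 <-]; rewrite -(ler_of_real k) of_real_modulus_norm Tc.
Qed.

Lemma opnorm_ge0 (T : bop) : 0 <= opnorm T.
Proof.
apply: ub_le_sup; first by have [] := has_sup_opnorm T.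
by exists 0; rewrite /= ?normr0// linear0 normr0 modulus0.
Qed.

Definition bop_nrm (T : bop) : K := of_real k (opnorm T).

Lemma bop_nrm_ge0 (T : bop) : 0 <= bop_nrm T.
Proof. by rewrite -(of_real0 R k) ler_of_real opnorm_ge0. Qed.

Lemma bop_nrmD (S T : bop) : bop_nrm (S + T) <= bop_nrm S + bop_nrm T.
Proof.
rewrite -of_realD ler_of_real; apply: opnorm_le => x x1.
rewrite of_realD (le_trans (ler_normD _ _))// lerD//.
  by rewrite (le_trans (le_opnorm _ _))// ler_piMr// bop_nrm_ge0.
by rewrite (le_trans (le_opnorm _ _))// ler_piMr// bop_nrm_ge0.
Qed.

Let bop_nrmZ_le (a : K) (T : bop) : bop_nrm (a *: T) <= `|a| * bop_nrm T.
Proof.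
rewrite norm_modulus -of_realM ler_of_real; apply: opnorm_le => x x1.
rewrite of_realM -norm_modulus normrZ ler_wpM2l//.
by rewrite (le_trans (le_opnorm _ _))// ler_piMr// bop_nrm_ge0.
Qed.

Lemma bop_nrmZ (a : K) (T : bop) : bop_nrm (a *: T) = `|a| * bop_nrm T.
Proof.
apply/le_anti; rewrite bop_nrmZ_le/=.
have [->|a0] := eqVneq a 0; first by rewrite normr0 mul0r bop_nrm_ge0.
rewrite -ler_pdivlMl ?normr_gt0// -normfV.
by rewrite -[X in bop_nrm X <= _](scalerK a0) bop_nrmZ_le.
Qed.

Lemma bop_nrm_eq0 (T : bop) : bop_nrm T = 0 -> T = 0.
Proof.
move=> T0; apply: bopP => x; apply/normr0_eq0/le_anti.
by rewrite normr_ge0 andbT (le_trans (le_opnorm _ _))// -/(bop_nrm T) T0 mul0r.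
Qed.

HB.instance Definition _ :=
  Lmodule_isNormed.Build K bop bop_nrmD bop_nrmZ bop_nrm_eq0.

End BoundedOperators.
Arguments bounded_pred {R k} E F.

Section Multiplication.
Variables (R : realType) (k : scalars).
Local Notation K := (scalar_field R k).

Lemma bop_comp_subproof (E F G : normedModType K) (S : bop F G) (T : bop E F) :
  (S \o T : E -> G) \in bounded_pred E G.
Proof.
apply/asboolP; split=> [a x y|]; first by rewrite /= !linearP.
exists (bop_nrm S * bop_nrm T) => x /=; rewrite -mulrA.
by rewrite (le_trans (le_opnorm _ _))// ler_wpM2l ?bop_nrm_ge0// le_opnorm.
Qed.

Definition bop_comp (E F G : normedModType K) (S : bop F G) (T : bop E F) :
  bop E G := Bop (bop_comp_subproof S T).

Variables E F G H : normedModType K.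

Lemma mulop_subproof (A : bop G H) (B : bop E F) :
  (fun T : bop F G => bop_comp A (bop_comp T B)) \in
    bounded_pred (bop F G) (bop E H).
Proof.
apply/asboolP; split=> [a S T|].
  by apply: bopP => x; rewrite /= linearP.
exists (`|A| * `|B|) => T.
rewrite -[`|bop_comp _ _|]/(of_real k _) -[`|A|]/(of_real k _).
rewrite -[`|B|]/(of_real k _) -[`|T|]/(of_real k _) -!of_realM ler_of_real.
apply: opnorm_le => x x1 /=; rewrite !of_realM.
rewrite (le_trans (le_opnorm _ _))// -mulrA ler_wpM2l ?bop_nrm_ge0// mulrC.
rewrite (le_trans (le_opnorm _ _))// ler_wpM2l ?bop_nrm_ge0//.
by rewrite (le_trans (le_opnorm _ _))// ler_piMr ?bop_nrm_ge0.
Qed.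

Definition mulop (A : bop G H) (B : bop E F) : bop (bop F G) (bop E H) :=
  Bop (mulop_subproof A B).

End Multiplication.

Section StrictlySingular.
Variables (R : realType) (k : scalars).
Local Notation K := (scalar_field R k).
Variables E F : normedModType K.

Definition finite_dimensional (V : set E) :=
  exists (n : nat) (e : 'I_n -> E), (forall i, V (e i)) /\
    forall x, V x -> exists c : 'I_n -> K, x = \sum_(i < n) c i *: e i.

(* S restricted to V is a homeomorphism onto its range; the inverse is given by
   a function on all of F of which only the values on the range matter. *)
Definition iso_onto_range (V : set E) (S : E -> F) :=
  {within V, continuous S} /\
  exists2 G : F -> E, {in V, cancel S G} & {within S @` V, continuous G}.

Definition strictly_singular (S : bop E F) :=
  forall V : set E, submod_closed [in V] -> ~ finite_dimensional V ->
    ~ iso_onto_range V S.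

End StrictlySingular.

(* Main.v *)
(* Suppose T |-> ATB is bounded below by c on an infinite-dimensional V.  Pick
   unit vectors T_i of V whose corners [0,n_i)^2 vanish.  By Pitt's theorem T_i
   is nearly supported on a finite square [0,n_{i+1})^2, so it consists of a
   diagonal block and of an L made of a column part (columns below n_i) and a
   row part.  After passing to a subfamily, the column parts are either
   negligible or some fixed column of every T_i has norm >= d; same for rows.
   A and B are almost block diagonal, so that for S = T_1 + ... + T_N
     |ASB| <= C (1 + [columns] N^(1/q) + [rows] N^(1 - 1/p)),
   whereas |S| is at least a constant times N^(1/p - 1/q) in all cases, N^(1/p)
   if the columns are not negligible, and N^(1 - 1/q) if the rows are not.  In
   each case |ASB| / |S| = O(N^(1/q - 1/p)), against |ASB| >= c |S|. *)

From HB Require Import structures.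
Require Import Defs.
From mathcomp Require Import all_boot all_order all_algebra.
From mathcomp Require Import all_classical all_reals all_analysis.
From mathcomp Require Import ring lra.

Set Implicit Arguments.
Unset Strict Implicit.
Unset Printing Implicit Defensive.

Import Order.TTheory GRing.Theory Num.Theory.
Import numFieldNormedType.Exports.

Local Open Scope ring_scope.

(** * Real-valued norms *)

(** The [T_i] cannot be made disjoint: finitely many linear conditions kill only a finite corner,
    and the columns below n_i of different [T_i] may overlap, as may the rows. Such overlaps let
    |ASB| grow, so they must be paid for by growth of |S|; hence the alternative between negligible
    parts and one fixed column or row of size d. The account balances because S acts from l_q to l_p
    and ASB from l_p to l_q. Overlapping columns end in disjoint blocks: they cost N^(1/q) in l_q,
    but a single unit vector already shows N^(1/p) in l_p. Overlapping rows start from disjoint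
    blocks: they cost N^(1 - 1/p) on l_p, but one coordinate collects N from a vector of norm
    N^(1/q). The tolerance e is of order d/N and fixed only after N, so that N errors stay below a
    fixed bound. *)

Section RealNorm.
Variables (R : realType) (k : scalars).
Local Notation K := (scalar_field R k).

(** The norm of the library takes values in [K], which may be complex; real powers and case
    distinctions by order need its real value. *)
Definition rnorm (V : normedModType K) (v : V) : R := modulus `|v|.

Lemma of_real_rnorm (V : normedModType K) (v : V) : of_real k (rnorm v) = `|v|.
Proof. exact: of_real_modulus_norm. Qed.

Section Space.
Variable V : normedModType K.
Implicit Types v w : V.

Lemma rnorm_ge0 v : 0 <= rnorm v. Proof. exact: modulus_ge0. Qed.

Lemma rnorm0 : rnorm (0 : V) = 0.
Proof. by rewrite /rnorm normr0 modulus0. Qed.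

Lemma rnorm_eq0 v : rnorm v = 0 -> v = 0.
Proof. by move=> /modulus_eq0 /normr0_eq0. Qed.

Lemma ler_rnormD v w : rnorm (v + w) <= rnorm v + rnorm w.
Proof. by rewrite -(ler_of_real k) of_realD !of_real_rnorm ler_normD. Qed.

Lemma rnormZ (a : K) v : rnorm (a *: v) = modulus a * rnorm v.
Proof.
apply: (@of_real_inj _ k).
by rewrite of_realM !of_real_rnorm normrZ norm_modulus.
Qed.

Lemma rnormN v : rnorm (- v) = rnorm v.
Proof. by rewrite /rnorm normrN. Qed.

Lemma ler_rnormB v w : rnorm (v - w) <= rnorm v + rnorm w.
Proof. by rewrite -(rnormN w) ler_rnormD. Qed.

Lemma ler_rnorm_sum I (r : seq I) (P : pred I) (F : I -> V) :
  rnorm (\sum_(i <- r | P i) F i) <= \sum_(i <- r | P i) rnorm (F i).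
Proof.
elim/big_ind2 : _ => [|v x w y vx wy|//]; first by rewrite rnorm0.
by rewrite (le_trans (ler_rnormD _ _))// lerD.
Qed.

End Space.

Lemma ltr_of_real (a b : R) : (of_real k a < of_real k b) = (a < b).
Proof. by rewrite !lt_neqAle ler_of_real (inj_eq (@of_real_inj _ k)). Qed.

Lemma modulus_of_real (a : R) : 0 <= a -> modulus (of_real k a) = a.
Proof.
move=> a0; apply: (@of_real_inj _ k); rewrite -norm_modulus ger0_norm//.
by rewrite -(of_real0 R k) ler_of_real.
Qed.

Lemma of_real_sum I (r : seq I) (P : pred I) (F : I -> R) :
  of_real k (\sum_(i <- r | P i) F i) = \sum_(i <- r | P i) of_real k (F i).
Proof. by apply: big_morph; [exact: of_realD|exact: of_real0]. Qed.

Section Operators.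
Variables E F : normedModType K.
Implicit Types S T : bop E F.

Lemma rnorm_bop T : rnorm T = opnorm T.
Proof. by rewrite /rnorm modulus_of_real ?opnorm_ge0. Qed.

Lemma le_rnorm_bop T x : rnorm (T x) <= rnorm T * rnorm x.
Proof.
rewrite rnorm_bop -(ler_of_real k) of_realM !of_real_rnorm; exact: le_opnorm.
Qed.

Lemma rnorm_bop_le T (c : R) : 0 <= c ->
  (forall x, rnorm x <= 1 -> rnorm (T x) <= c) -> rnorm T <= c.
Proof.
move=> c0 Tc; rewrite rnorm_bop; apply: opnorm_le => x.
rewrite -of_real_rnorm -(of_real1 R k) ler_of_real => /Tc.
by rewrite -(ler_of_real k) of_real_rnorm.
Qed.

Lemma rnorm_bop_gt T (c : R) : 0 <= c -> c < rnorm T ->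
  exists2 x, rnorm x <= 1 & c < rnorm (T x).
Proof.
move=> c0; apply: contraPP => H; apply/negP; rewrite -leNgt.
apply: rnorm_bop_le => // x x1; rewrite leNgt; apply/negP => cx.
by apply: H; exists x.
Qed.

Lemma bop_sumE I (r : seq I) (P : pred I) (T_ : I -> bop E F) x :
  (\sum_(i <- r | P i) T_ i) x = \sum_(i <- r | P i) T_ i x.
Proof. by elim/big_rec2 : _ => // i S y _ <-. Qed.

Lemma bop_addE S T x : (S + T) x = S x + T x. Proof. by []. Qed.

Lemma bop_scaleE c T x : (c *: T) x = c *: T x. Proof. by []. Qed.

Lemma bopZE T c x : T (c *: x) = c *: T x. Proof. exact: linearZ. Qed.

Lemma bop_sum T I (r : seq I) (P : pred I) (x : I -> E) :
  T (\sum_(i <- r | P i) x i) = \sum_(i <- r | P i) T (x i).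
Proof. exact: linear_sum. Qed.

End Operators.

Lemma rnorm_scale_unit (V : normedModType K) (v : V) : v != 0 ->
  rnorm (of_real k (rnorm v)^-1 *: v) = 1.
Proof.
move=> v0; have r0 : 0 < rnorm v.
  rewrite lt_neqAle rnorm_ge0 andbT eq_sym; apply: contra v0 => /eqP.
  by move=> /rnorm_eq0 ->.
by rewrite rnormZ modulus_of_real ?invr_ge0 ?ltW// mulVf// gt_eqF.
Qed.

Lemma rnorm_gt0 (V : normedModType K) (v : V) : (0 < rnorm v) = (v != 0).
Proof.
rewrite lt_neqAle rnorm_ge0 andbT eq_sym; congr (~~ _); apply/eqP/eqP.
  exact: rnorm_eq0.
by move->; rewrite rnorm0.
Qed.

End RealNorm.

(** * Restrictions of sequences to sets of indices *)

Section Lp.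
Variables (R : realType) (k : scalars) (p : R) (p1 : 1 <= p).
Local Notation K := (scalar_field R k).
Local Notation E := (lp k p1).
Implicit Types (x y : E) (P Q : pred nat).

Let p_gt0 : 0 < p. Proof. exact: lt_le_trans p1. Qed.
Let p_ge0 : 0 <= p. Proof. exact: ltW. Qed.

Lemma lp_ext x y : (forall n, x n = y n) -> x = y.
Proof. by move=> xy; apply/val_inj/funext. Qed.

Lemma lp0E n : (0 : E) n = 0. Proof. by []. Qed.
Lemma lpDE x y n : (x + y) n = x n + y n. Proof. by []. Qed.
Lemma lpNE x n : (- x) n = - x n. Proof. by []. Qed.
Lemma lpZE (a : K) x n : (a *: x) n = a * x n. Proof. by []. Qed.
Lemma lp_sumE I (r : seq I) (Q : pred I) (F : I -> E) n :
  (\sum_(i <- r | Q i) F i) n = \sum_(i <- r | Q i) F i n.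
Proof. by elim/big_rec2 : _ => // i S y _ <-. Qed.

Lemma rnorm_lp x : rnorm x = fine (lp_norm p x).
Proof. by rewrite /rnorm modulus_of_real ?fine_ge0 ?lp_norm_ge0. Qed.

Lemma rnorm_pow x :
  ((rnorm x `^ p)%:E = \sum_(0 <= n <oo) (modulus (x n) `^ p)%:E)%E.
Proof.
rewrite rnorm_lp -poweR_EFin fineK ?lp_norm_fin// lp_normE//.
rewrite -poweRrM mulVf ?gt_eqF// poweRe1//.
by apply: nneseries_ge0 => *; rewrite lee_fin powR_ge0.
Qed.

Lemma restr_subproof P x : (fun n => if P n then x n else 0) \in lp_pred p1.
Proof.
apply/asboolP; rewrite lp_normE//.
have /asboolP := lp_valP x; apply: le_lt_trans; rewrite lp_normE//.
apply: gt0_ler_poweR; rewrite ?invr_ge0// ?in_itv/= ?leey ?andbT.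
- by apply: nneseries_ge0 => *; rewrite lee_fin powR_ge0.
- by apply: nneseries_ge0 => *; rewrite lee_fin powR_ge0.
apply: lee_nneseries => [n _ _|n _]; first by rewrite lee_fin powR_ge0.
rewrite lee_fin; case: ifP => // _; rewrite modulus0 powR0 ?gt_eqF//.
exact: powR_ge0.
Qed.

Definition restr P x : E := Lp (restr_subproof P x).

Lemma restrE P x n : restr P x n = if P n then x n else 0. Proof. by []. Qed.

Lemma restr_linear P : linear (restr P).
Proof.
move=> a x y; apply: lp_ext => n; rewrite lpDE lpZE !restrE.
by case: (P n); rewrite ?mulr0 ?addr0.
Qed.

HB.instance Definition _ P :=
  GRing.isLinear.Build K E E _ (restr P) (restr_linear P).

Lemma restr_restr P Q x : restr P (restr Q x) = restr (predI P Q) x.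
Proof. by apply: lp_ext => n; rewrite !restrE /=; case: (P n). Qed.

Lemma eq_restr P Q x : P =1 Q -> restr P x = restr Q x.
Proof. by move=> PQ; apply: lp_ext => n; rewrite !restrE PQ. Qed.

Lemma restr_predT x : restr predT x = x. Proof. exact: lp_ext. Qed.

Lemma restr_disjoint P Q x : (forall n, P n -> ~~ Q n) ->
  restr P (restr Q x) = 0.
Proof.
move=> PQ; apply: lp_ext => n; rewrite !restrE.
by have := PQ n; case: (P n) => // /(_ isT) /negbTE ->.
Qed.

Lemma restr_sub P Q x : {subset P <= Q} -> restr Q (restr P x) = restr P x.
Proof.
move=> PQ; apply: lp_ext => n; rewrite !restrE.
by case: ifPn => // Qn; case: ifPn => // /PQ; rewrite -topredE /= (negbTE Qn).
Qed.

Lemma rnorm_pow_restrD P Q x : (forall n, P n -> ~~ Q n) ->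
  rnorm (restr (predU P Q) x) `^ p =
  rnorm (restr P x) `^ p + rnorm (restr Q x) `^ p.
Proof.
move=> PQ; apply: EFin_inj; rewrite EFinD !rnorm_pow -nneseriesD; last 2 first.
- by move=> *; rewrite lee_fin powR_ge0.
- by move=> *; rewrite lee_fin powR_ge0.
apply: eq_eseriesr => n _; rewrite -EFinD !restrE /=.
have := PQ n; case: (P n) => /= [/(_ isT)/negbTE ->|_].
  by rewrite modulus0 powR0 ?gt_eqF// addr0.
by rewrite modulus0 powR0 ?gt_eqF// add0r.
Qed.

Lemma rnorm_restr P x : rnorm (restr P x) <= rnorm x.
Proof.
have : rnorm (restr P x) `^ p <= rnorm x `^ p.
  rewrite -[X in _ <= rnorm X `^ p]restr_predT.
  rewrite (@eq_restr predT (predU P (predC P))); last first.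
    by move=> n /=; rewrite orbN.
  by rewrite rnorm_pow_restrD ?lerDl ?powR_ge0// => n /=; rewrite negbK.
by apply: contraTT; rewrite -!ltNge; apply: gt0_ltr_powR => //;
  rewrite nnegrE rnorm_ge0.
Qed.

Lemma rnorm_restr_sub P Q x : (forall n, P n -> Q n) ->
  rnorm (restr P x) <= rnorm (restr Q x).
Proof.
move=> PQ; rewrite (_ : restr P x = restr P (restr Q x)) ?rnorm_restr//.
by rewrite restr_restr; apply: eq_restr => n /=; apply/esym/andb_idr/PQ.
Qed.

Lemma rnorm_single j x : rnorm (restr (pred1 j) x) = modulus (x j).
Proof.
have : (rnorm (restr (pred1 j) x) `^ p)%:E = (modulus (x j) `^ p)%:E.
  rewrite rnorm_pow (@nneseriesD1 _ _ j)//; last first.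
    by move=> *; rewrite lee_fin powR_ge0.
  rewrite restrE /= eqxx eseries0 ?adde0// => n _ nj.
  by rewrite (negbTE nj) modulus0 powR0 ?gt_eqF.
case; apply: powR_injective => //; rewrite nnegrE ?rnorm_ge0 ?modulus_ge0//.
Qed.

Lemma modulus_coord j x : modulus (x j) <= rnorm x.
Proof. by rewrite -rnorm_single rnorm_restr. Qed.

End Lp.

Notation lp_head s := (restr (fun n : nat => (n < s)%N)).
Notation lp_tail s := (restr (fun n : nat => (s <= n)%N)).
Notation lp_mid s t := (restr (fun n : nat => (s <= n < t)%N)).

Section Cuts.
Variables (R : realType) (k : scalars) (p : R) (p1 : 1 <= p).
Local Notation K := (scalar_field R k).
Local Notation E := (lp k p1).
Implicit Types (x y : E) (P Q : pred nat).

Let p_gt0 : 0 < p. Proof. exact: lt_le_trans p1. Qed.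

Lemma head_tail s x : x = lp_head s x + lp_tail s x.
Proof.
by apply: lp_ext => n; rewrite lpDE !restrE; case: ltnP; rewrite ?addr0 ?add0r.
Qed.

Lemma head_mid_tail s t x : (s <= t)%N ->
  x = lp_head s x + lp_mid s t x + lp_tail t x.
Proof.
move=> st; apply: lp_ext => n; rewrite !lpDE !restrE.
case: (ltnP n s) => ns /=.
  by rewrite leqNgt (leq_trans ns st) /= !addr0.
by case: (ltnP n t) => nt /=; rewrite ?addr0 ?add0r.
Qed.

Lemma tail_tail s t x : (s <= t)%N -> lp_tail t x = lp_tail s (lp_tail t x).
Proof.
by move=> st; rewrite restr_sub// => n; rewrite -!topredE/=; exact: leq_trans.
Qed.

Lemma rnorm_tail_cvg x (e : R) : 0 < e ->
  exists s, forall t, (s <= t)%N -> rnorm (lp_tail t x) <= e.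
Proof.
move=> e0.
have /nneseries_tail_cvg : (\sum_(0 <= n <oo) (modulus (x n) `^ p)%:E < +oo)%E.
  by rewrite -rnorm_pow ltry.
have pos n : (0 <= (modulus (x n) `^ p)%:E)%E by rewrite lee_fin powR_ge0.
move=> /(_ (fun n _ => pos n)) /fine_cvgP[_] /cvgrPdist_le.
move=> /(_ _ (powR_gt0 p e0)) [s _ sP]; exists s.
have tailE t : (rnorm (lp_tail t x) `^ p)%:E =
    (\sum_(t <= n <oo) (modulus (x n) `^ p)%:E)%E.
  rewrite rnorm_pow [RHS]eseries_cond [RHS]eseries_mkcondr.
  apply: eq_eseriesr => n _.
  by rewrite restrE /=; case: ifP => // _; rewrite modulus0 powR0 ?gt_eqF.
move=> t /= /sP.
rewrite /= -tailE sub0r normrN ger0_norm ?powR_ge0//.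
apply: contraTT; rewrite -!ltNge; apply: gt0_ltr_powR => //.
  by rewrite nnegrE ltW.
by rewrite nnegrE rnorm_ge0.
Qed.

End Cuts.

(** * Successive blocks *)

Lemma ler_powRE (R : realType) (x y p : R) : 0 < p -> 0 <= x -> 0 <= y ->
  (x `^ p <= y `^ p) = (x <= y).
Proof.
move=> p0 x0 y0; apply/idP/idP; last first.
  by move=> xy; apply: ge0_ler_powR => //; exact: ltW.
by apply: contraTT; rewrite -!ltNge; apply: gt0_ltr_powR.
Qed.

Lemma powR_le1 (R : realType) (x p : R) : 0 < p -> 0 <= x -> x <= 1 ->
  x `^ p <= 1.
Proof. by move=> p0 x0 x1; have := ler_powRE p0 x0 ler01; rewrite powR1 x1. Qed.

Lemma powRVK (R : realType) (x p : R) : p != 0 -> 0 <= x ->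
  (x `^ p^-1) `^ p = x.
Proof. by move=> p0 x0; rewrite -powRrM mulVf// powRr1. Qed.

Section Blocks.
Variables (R : realType) (k : scalars) (p : R) (p1 : 1 <= p).
Variables (a : nat -> nat) (a_homo : forall i, (a i <= a i.+1)%N).
Local Notation E := (lp k p1).
Local Notation blk i := (lp_mid (a i) (a i.+1)).
Implicit Types x y : E.

Let p_gt0 : 0 < p. Proof. exact: lt_le_trans p1. Qed.

Let a_leq i j : (i <= j)%N -> (a i <= a j)%N.
Proof. by move=> ij; apply: (homo_leq leqnn (@leq_trans) a_homo). Qed.

Lemma blk_disjoint i j x : i != j -> blk i (blk j x) = 0.
Proof.
rewrite neq_ltn => /orP[] /a_leq ij; apply: restr_disjoint => n /andP[ln un].
  by rewrite leqNgt (leq_trans un ij).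
by rewrite negb_and -(leqNgt (a j.+1)) (leq_trans ij ln) orbT.
Qed.

Lemma blk_sum N (z : nat -> E) i : (i < N)%N ->
  blk i (\sum_(l < N) blk l (z l)) = blk i (z i).
Proof.
move=> iN; rewrite linear_sum (bigD1 (Ordinal iN))//= big1 ?addr0.
  by rewrite restr_sub.
by move=> l li; apply: blk_disjoint; rewrite eq_sym.
Qed.

Lemma sum_blk_pow N x :
  \sum_(i < N) rnorm (blk i x) `^ p = rnorm (lp_mid (a 0) (a N) x) `^ p.
Proof.
elim: N => [|N IH].
  rewrite big_ord0 (@eq_restr _ _ _ _ _ pred0) => [|n]; last first.
    by rewrite /= ltnNge andbN.
  rewrite (_ : restr _ _ = 0) ?rnorm0 ?powR0 ?gt_eqF//; exact: lp_ext.
rewrite big_ord_recr/= IH -rnorm_pow_restrD => [|n /andP[_ un]]; last first.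
  by rewrite negb_and -ltnNge un.
congr (rnorm _ `^ p); apply: eq_restr => n /=.
have [naN|aNn] := ltnP n (a N).
  by rewrite (leq_trans naN (a_homo N)) !andbT orbF.
by rewrite andbF /= (leq_trans (a_leq (leq0n N)) aNn).
Qed.

Lemma sum_blk_pow_le N x : \sum_(i < N) rnorm (blk i x) `^ p <= rnorm x `^ p.
Proof. by rewrite sum_blk_pow ler_powRE ?rnorm_ge0 ?rnorm_restr. Qed.

Lemma rnorm_sum_blk N (z : nat -> E) :
  rnorm (\sum_(i < N) blk i (z i)) `^ p = \sum_(i < N) rnorm (blk i (z i)) `^ p.
Proof.
under [RHS]eq_bigr => i _ do rewrite -(@blk_sum N)//.
rewrite sum_blk_pow; congr (rnorm _ `^ p).
rewrite linear_sum; apply: eq_bigr => i _ /=; rewrite restr_sub// => n.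
rewrite -!topredE/= => /andP[ln un].
by rewrite (leq_trans (a_leq (leq0n i)) ln) (leq_trans un)//; exact: a_leq.
Qed.

Lemma rnorm_sum_blk_le N (z : nat -> E) (c : R) : 0 <= c ->
  (forall i, rnorm (blk i (z i)) <= c) ->
  rnorm (\sum_(i < N) blk i (z i)) <= c * N%:R `^ p^-1.
Proof.
move=> c0 zc; rewrite -(@ler_powRE _ _ _ p)// ?rnorm_ge0 ?mulr_ge0 ?powR_ge0//.
rewrite powRM// ?powR_ge0// powRVK ?gt_eqF// rnorm_sum_blk.
rewrite mulr_natr -[X in _ *+ X]card_ord -sumr_const.
by apply: ler_sum => i _; rewrite ler_powRE ?rnorm_ge0.
Qed.

(** The exact blocks are disjoint, so their sum has norm at least c N^(1/p); returning to the [w i]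
    costs e per term by the triangle inequality. *)
Lemma rnorm_sum_blk_ge N (w : nat -> E) (c e : R) : 0 <= c ->
  (forall i, c <= rnorm (blk i (w i))) ->
  (forall i, rnorm (w i - blk i (w i)) <= e) ->
  c * N%:R `^ p^-1 <= rnorm (\sum_(i < N) w i) + N%:R * e.
Proof.
move=> c0 cw we; have H : c * N%:R `^ p^-1 <= rnorm (\sum_(i < N) blk i (w i)).
  rewrite -(@ler_powRE _ _ _ p)// ?rnorm_ge0 ?mulr_ge0 ?powR_ge0//.
  rewrite powRM// ?powR_ge0// powRVK ?gt_eqF// rnorm_sum_blk.
  rewrite mulr_natr -[X in _ *+ X]card_ord -sumr_const.
  by apply: ler_sum => i _; rewrite ler_powRE ?rnorm_ge0.
apply: le_trans H _.
have -> : \sum_(i < N) blk i (w i) =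
    \sum_(i < N) w i - \sum_(i < N) (w i - blk i (w i)).
  by rewrite sumrB opprB addrC subrK.
rewrite (le_trans (ler_rnormB _ _))// lerD2l.
rewrite (le_trans (ler_rnorm_sum _ _ _))// mulr_natl -[X in _ *+ X]card_ord.
by rewrite -sumr_const; apply: ler_sum.
Qed.

(* Hoelder's inequality for N terms, by Young's inequality for each term and
   the constant N^(1/p - 1). *)
Lemma sum_rnorm_blk_le N x : 1 < p -> rnorm x <= 1 ->
  \sum_(i < N) rnorm (blk i x) <= N%:R `^ (1 - p^-1).
Proof.
move=> lt1p x1; have [->|N0] := eqVneq N 0%N.
  by rewrite big_ord0 powR_ge0.
have N0' : (0 : R) < N%:R by rewrite ltr0n lt0n.
have b_gt0 : 0 < 1 - p^-1 by rewrite subr_gt0 invf_lt1.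
set b := 1 - p^-1 in b_gt0 *.
have pb : p^-1 + b^-1^-1 = 1 by rewrite invrK /b addrC subrK.
rewrite -[leRHS]mul1r -ler_pdivrMr ?powR_gt0// mulr_suml.
apply: (@le_trans _ _ (\sum_(i < N) (rnorm (blk i x) `^ p / p + N%:R^-1 * b))).
  apply: ler_sum => i _.
  have := @conjugate_powR _ (rnorm (blk i x)) (N%:R `^ b)^-1 p b^-1.
  rewrite rnorm_ge0 invr_ge0 powR_ge0 invr_gt0 => /(_ isT isT p_gt0 b_gt0 pb).
  rewrite invrK -powRN -powRrM mulNr mulfV ?gt_eqF// powR_inv1 ?ler0n//.
rewrite big_split/= -mulr_suml sumr_const card_ord -mulrnAl -mulr_natl.
rewrite mulfV ?gt_eqF// mul1r /b -[leRHS](subrK p^-1) [leRHS]addrC lerD2r.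
rewrite ler_piMl//.
  by rewrite invr_ge0 ltW.
rewrite (le_trans (sum_blk_pow_le _ _))//.
by apply: powR_le1; rewrite ?rnorm_ge0.
Qed.

End Blocks.

(** The block norms of x are at most 1, so [p <= q] makes their q-th powers at most their p-th
    powers, which sum to at most 1. Hence block diagonal maps from l_p to l_q have bounds
    independent of N. *)
Lemma rnorm_sum_blk_dominated (R : realType) (k : scalars) (p q : R)
    (p1 : 1 <= p) (q1 : 1 <= q) (a : nat -> nat) N
    (x : lp k p1) (z : nat -> lp k q1) (c : R) :
  (forall i, (a i <= a i.+1)%N) -> p <= q -> 0 <= c -> rnorm x <= 1 ->
  (forall i, rnorm (lp_mid (a i) (a i.+1) (z i))
    <= c * rnorm (lp_mid (a i) (a i.+1) x)) ->
  rnorm (\sum_(i < N) lp_mid (a i) (a i.+1) (z i)) <= c.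
Proof.
move=> ha pq c0 x1 zx; have p0 : 0 < p by exact: (lt_le_trans ltr01 p1).
have q0 : 0 < q by exact: (lt_le_trans ltr01 q1).
rewrite -(@ler_powRE _ _ _ q)// ?rnorm_ge0// rnorm_sum_blk//.
apply: (@le_trans _ _
  (\sum_(i < N) c `^ q * rnorm (lp_mid (a i) (a i.+1) x) `^ p)).
  apply: ler_sum => i _; set u := rnorm (lp_mid _ _ x).
  apply: (@le_trans _ _ ((c * u) `^ q)).
    by rewrite ler_powRE ?mulr_ge0 ?rnorm_ge0 ?zx.
  rewrite powRM ?rnorm_ge0// ler_wpM2l ?powR_ge0//.
  have [->|u0] := eqVneq u 0; first by rewrite !powR0 ?gt_eqF.
  apply: ger_powR => //; rewrite lt_neqAle eq_sym u0 rnorm_ge0/=.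
  exact: le_trans (rnorm_restr _ _) x1.
rewrite -mulr_sumr ler_piMr ?powR_ge0// (le_trans (sum_blk_pow_le _ _ _))//.
by apply: powR_le1; rewrite ?rnorm_ge0.
Qed.

Section UnitVectors.
Variables (R : realType) (k : scalars) (p : R) (p1 : 1 <= p).
Local Notation K := (scalar_field R k).
Local Notation E := (lp k p1).
Implicit Types x y : E.

Let p_gt0 : 0 < p. Proof. exact: lt_le_trans p1. Qed.

Lemma lp_unit_subproof j :
  (fun n => if n == j then 1 else 0 : K) \in lp_pred p1.
Proof.
apply/asboolP; rewrite lp_normE// (@nneseriesD1 _ _ j)//; last first.
  by move=> *; rewrite lee_fin powR_ge0.
rewrite eseries0 ?adde0 ?poweR_EFin ?ltry// => n _ nj.
by rewrite (negbTE nj) modulus0 powR0 ?gt_eqF.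
Qed.

Definition lp_unit j : E := Lp (lp_unit_subproof j).

Lemma lp_unitE j n : lp_unit j n = if n == j then 1 else 0. Proof. by []. Qed.

Lemma rnorm_unit j : rnorm (lp_unit j) = 1.
Proof.
have -> : lp_unit j = restr (pred1 j) (lp_unit j).
  by apply: lp_ext => n; rewrite restrE !lp_unitE /=; case: eqP.
rewrite rnorm_single lp_unitE eqxx; apply: (@of_real_inj _ k).
by rewrite -norm_modulus normr1 of_real1.
Qed.

Lemma head_sum s x : lp_head s x = \sum_(j < s) x j *: lp_unit j.
Proof.
apply: lp_ext => n; rewrite lp_sumE restrE; case: ltnP => [ns|sn].
  rewrite (bigD1 (Ordinal ns))// big1 => [|j jn].
    by rewrite lpZE lp_unitE eqxx mulr1 /= addr0.
  rewrite lpZE lp_unitE ifN ?mulr0//; apply: contra jn => /eqP nj.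
  by apply/eqP/val_inj.
rewrite big1// => j _; rewrite lpZE lp_unitE ifN ?mulr0//.
by rewrite neq_ltn (leq_trans (ltn_ord j) sn) orbT.
Qed.

Lemma rnorm_head_le s x : rnorm (lp_head s x) <= \sum_(j < s) modulus (x j).
Proof.
rewrite head_sum (le_trans (ler_rnorm_sum _ _ _))//.
by apply: ler_sum => j _; rewrite rnormZ rnorm_unit mulr1.
Qed.

Lemma linear_head_le (F : normedModType K) (f : {linear E -> F}) s x (e : R) :
  (forall j, (j < s)%N -> rnorm (f (lp_unit j)) <= e) ->
  rnorm (f (lp_head s x)) <= s%:R * e * rnorm x.
Proof.
move=> fe; rewrite head_sum linear_sum (le_trans (ler_rnorm_sum _ _ _))//.
rewrite -mulrA mulr_natl -[X in _ *+ X]card_ord -sumr_const.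
apply: ler_sum => j _; rewrite linearZ rnormZ mulrC ler_pM ?rnorm_ge0//.
- exact: modulus_ge0.
- exact: fe.
- exact: modulus_coord.
Qed.

End UnitVectors.
Arguments lp_unit {R k p p1} j.

(** * Gliding humps and Pitt's theorem *)

(** The recursion behind every gliding hump below: a step only needs to know where the previous one
    ended, so one choice function, iterated from 0, suffices. *)
Lemma ex_chain (D : Type) (P : nat -> D -> nat -> Prop) :
  (forall m, exists d m', P m d m') ->
  exists (a : nat -> nat) (d : nat -> D), forall i, P (a i) (d i) (a i.+1).
Proof.
move=> H; have /choice[f fP] : forall m, exists u, P m u.1 u.2.
  by move=> m; have [d [m' Pm]] := H m; exists (d, m').
pose a i := iter i (fun m => (f m).2) 0%N.
by exists a, (fun i => (f (a i)).1) => i; exact: fP.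
Qed.

Lemma powR_unbounded (R : realType) (t C : R) : 0 < t ->
  exists2 N : nat, (0 < N)%N & C < N%:R `^ t.
Proof.
move=> t0; have := archi_boundP (powR_ge0 (`|C| + 1) t^-1).
set N := Num.bound _ => CN; have N0 : (0 : R) < N%:R.
  by rewrite (le_lt_trans _ CN)// powR_ge0.
exists N; first by rewrite -(ltr0n R).
apply: (@lt_le_trans _ _ (`|C| + 1)); first by rewrite ltr_pwDr// ler_norm.
rewrite -[leLHS](@powRVK _ _ t) ?gt_eqF ?addr_ge0//.
by rewrite ler_powRE ?powR_ge0 ?(ltW CN) ?(ltW N0).
Qed.

Lemma powR_gap (R : realType) (s t c C : R) : s < t -> 0 < c ->
  exists2 N : nat, (0 < N)%N & C * N%:R `^ s < c * N%:R `^ t.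
Proof.
move=> st c0; have [|N N0 NC] := @powR_unbounded R (t - s) (C / c).
  by rewrite subr_gt0.
have N0' : (0 : R) < N%:R by rewrite ltr0n.
exists N => //; rewrite -[t in ltRHS](subrK s).
rewrite powRD; last by rewrite (gt_eqF N0') implybT.
by rewrite mulrA ltr_pM2r ?powR_gt0// mulrC -ltr_pdivrMr.
Qed.

(** Rotates test vectors so that their values at one coordinate add up without cancellation, over
    either field. *)
Lemma ex_phase (R : realType) (k : scalars) (z : scalar_field R k) :
  exists2 c, modulus c = 1 & c * z = of_real k (modulus z).
Proof.
have [->|z0] := eqVneq z 0.
  exists 1; last by rewrite mulr0 modulus0 of_real0.
  by apply: (@of_real_inj _ k); rewrite -norm_modulus normr1 of_real1.
exists (`|z| / z); last by rewrite divfK// norm_modulus.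
apply: (@of_real_inj _ k); rewrite -norm_modulus normrM normfV normr_id.
by rewrite mulfV ?normr_eq0// of_real1.
Qed.

Section GlidingHump.
Variables (R : realType) (k : scalars) (q r : R) (q1 : 1 <= q) (r1 : 1 <= r).
Variable T : bop (lp k q1) (lp k r1).
Local Notation K := (scalar_field R k).

(** A normalised witness beyond s is cut off at a t so large that its image loses at most e / 2. The
    set [P] is a single coordinate in [op_coord_tail_cvg] and everything in [pitt]. *)
Lemma gliding_hump (P : pred nat) (e : R) : 0 < e ->
  ~ (exists s, forall x, rnorm (restr P (T (lp_tail s x))) <= e * rnorm x) ->
  forall s, exists x t, [/\ (s <= t)%N, rnorm x <= 1, lp_mid s t x = x &
    e / 2 <= rnorm (restr P (T x))].
Proof.
move=> e0 H s.
have [x Px] : exists x, e * rnorm x < rnorm (restr P (T (lp_tail s x))).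
  apply: contrapT => Hx; apply: H; exists s => x; rewrite leNgt.
  by apply/negP => xe; apply: Hx; exists x.
have x0 : x != 0.
  apply/eqP => x0; move: Px; rewrite x0 rnorm0 mulr0.
  by rewrite !linear0 rnorm0 ltxx.
pose y := of_real k (rnorm x)^-1 *: lp_tail s x.
have y1 : rnorm y <= 1.
  rewrite -(rnorm_scale_unit x0) !rnormZ ler_wpM2l ?modulus_ge0//.
  exact: rnorm_restr.
have ey : e < rnorm (restr P (T y)).
  rewrite !linearZ/= rnormZ modulus_of_real ?invr_ge0 ?rnorm_ge0//.
  by rewrite mulrC ltr_pdivlMr ?rnorm_gt0.
have sy : lp_tail s y = y.
  by rewrite linearZ/= restr_restr; congr (_ *: _); apply: eq_restr => n /=;
     rewrite andbb.
(* The summand 1 keeps the divisor positive without knowing that [T] is nonzero. *)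
have T0 : 0 < 2 * (rnorm T + 1) by rewrite mulr_gt0// ltr_wpDl ?rnorm_ge0.
have [t0 t0P] := rnorm_tail_cvg y (divr_gt0 e0 T0).
pose t := maxn s t0; have st : (s <= t)%N by exact: leq_maxl.
exists (lp_mid s t y), t; split=> //.
- exact: le_trans (rnorm_restr _ _) y1.
- by rewrite restr_sub.
have yE : y = lp_mid s t y + lp_tail t y.
  rewrite {1}(head_mid_tail y st) -{1}sy restr_disjoint ?add0r// => n.
  by rewrite -ltnNge.
have {t0P} yt := t0P t (leq_maxr _ _).
apply: (@le_trans _ _ (e - e / 2)); first by lra.
rewrite lerBlDr (le_trans (ltW ey))// {1}yE !linearD/=.
rewrite (le_trans (ler_rnormD _ _))//.
rewrite lerD2l (le_trans (rnorm_restr _ _))// (le_trans (le_rnorm_bop _ _))//.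
apply: (@le_trans _ _ ((rnorm T + 1) * (e / (2 * (rnorm T + 1))))).
  by rewrite ler_pM ?rnorm_ge0// lerDl.
rewrite le_eqVlt; apply/orP; left; apply/eqP.
have ? : rnorm T + 1 != 0 by rewrite gt_eqF// ltr_wpDl ?rnorm_ge0.
by field.
Qed.

(** The images of heads lie in the span of m vectors [T (lp_unit j)], whose tails are small
    simultaneously. *)
Lemma op_head_tail_cvg m (e : R) : 0 < e ->
  exists s0, forall s x, (s0 <= s)%N ->
    rnorm (lp_tail s (T (lp_head m x))) <= e * rnorm x.
Proof.
move=> e0; have [s0 s0P] : exists s0, forall s j, (s0 <= s)%N -> (j < m)%N ->
    rnorm (lp_tail s (T (lp_unit j))) <= e / m.+1%:R.
  elim: {1}m => [|n [s0 IH]]; first by exists 0%N.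
  have [|s1 s1P] := rnorm_tail_cvg (T (lp_unit n)) (_ : 0 < e / m.+1%:R).
    by rewrite divr_gt0.
  exists (maxn s0 s1) => s j; rewrite geq_max ltnS => /andP[ss0 ss1].
  by rewrite leq_eqVlt => /predU1P[->|/IH]; [exact: s1P|exact].
exists s0 => s x ss0; rewrite head_sum !linear_sum/=.
rewrite (le_trans (ler_rnorm_sum _ _ _))//.
apply: (@le_trans _ _ (\sum_(i < m) (e / m.+1%:R * rnorm x))).
  apply: ler_sum => j _; rewrite !linearZ/= rnormZ mulrC.
  by rewrite ler_pM ?rnorm_ge0 ?modulus_ge0 ?modulus_coord ?s0P.
rewrite sumr_const card_ord -[leLHS]mulr_natl mulrA ler_wpM2r ?rnorm_ge0//.
by rewrite mulrCA ler_piMr ?(ltW e0)// ler_pdivrMr ?ltr0n// mul1r ler_nat.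
Qed.

(* The coordinate functional x |-> (T x) j acts on l_q with q > 1, so N disjoint
   humps of norm 1 would give it the size N on a vector of norm N^(1/q). *)
Lemma op_coord_tail_cvg j (e : R) : 1 < q -> 0 < e ->
  exists s0, forall s x, (s0 <= s)%N ->
    rnorm (restr (pred1 j) (T (lp_tail s x))) <= e * rnorm x.
Proof.
move=> lt1q e0.
suff [s0 s0P] : exists s, forall x,
    rnorm (restr (pred1 j) (T (lp_tail s x))) <= e * rnorm x.
  exists s0 => s x ss0; rewrite (tail_tail _ ss0) (le_trans (s0P _))//.
  by rewrite ler_wpM2l ?(ltW e0)// rnorm_restr.
apply: contrapT => /(gliding_hump e0)/ex_chain[a [x aP]].
have a_homo i : (a i <= a i.+1)%N by case: (aP i).
have /choice[c cP] : forall i, exists c, modulus c = 1 /\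
    c * T (x i) j = of_real k (modulus (T (x i) j)).
  by move=> i; have [c c1 c2] := ex_phase (T (x i) j); exists c.
have [|N N0] := @powR_gap R q^-1 1 (e / 2) (rnorm T) _
  (divr_gt0 e0 (ltr0Sn R 1)).
  by rewrite invf_lt1// (lt_trans ltr01).
apply/negP; rewrite -leNgt powRr1 ?ler0n//.
pose y i := c i *: x i.
have yE i : lp_mid (a i) (a i.+1) (y i) = y i.
  by rewrite linearZ/=; case: (aP i) => _ _ ->.
have yle : rnorm (\sum_(i < N) y i) <= N%:R `^ q^-1.
  under eq_bigr do rewrite -yE; rewrite -[leRHS]mul1r.
  apply: rnorm_sum_blk_le => // i; rewrite yE rnormZ (proj1 (cP i)) mul1r.
  by case: (aP i).
apply: le_trans (_ : rnorm (T (\sum_(i < N) y i)) <= _); last first.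
  by rewrite (le_trans (le_rnorm_bop _ _))// ler_wpM2l ?rnorm_ge0.
apply: le_trans (modulus_coord j _); rewrite bop_sum lp_sumE.
under [in leRHS]eq_bigr do rewrite /y bopZE lpZE (proj2 (cP _)).
rewrite -of_real_sum modulus_of_real ?sumr_ge0// => [|i _]; last first.
  exact: modulus_ge0.
rewrite mulr_natr -[X in _ *+ X]card_ord -sumr_const; apply: ler_sum => i _.
by rewrite -rnorm_single; case: (aP i).
Qed.

(** The dual of [op_head_tail_cvg], by adding one coordinate at a time and halving e. It fails for q
    = 1, where the sum of all coordinates is a bounded functional. *)
Lemma op_tail_head_cvg m (e : R) : 1 < q -> 0 < e ->
  exists s0, forall s x, (s0 <= s)%N ->
    rnorm (lp_head m (T (lp_tail s x))) <= e * rnorm x.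
Proof.
move=> lt1q; elim: m e => [|m IH] e e0.
  exists 0%N => s x _; rewrite (_ : restr _ _ = 0) ?rnorm0; last exact: lp_ext.
  by rewrite mulr_ge0 ?rnorm_ge0 ?ltW.
have e20 : 0 < e / 2 by rewrite divr_gt0.
have [s0 s0P] := IH _ e20; have [s1 s1P] := op_coord_tail_cvg m lt1q e20.
exists (maxn s0 s1) => s x; rewrite geq_max => /andP[ss0 ss1].
set z := T _; have -> : lp_head m.+1 z = lp_head m z + restr (pred1 m) z.
  apply: lp_ext => n; rewrite lpDE !restrE /= ltnS leq_eqVlt.
  by have [->|_] := eqVneq n m; rewrite ?ltnn /= ?add0r ?addr0.
rewrite (le_trans (ler_rnormD _ _))//.
by rewrite [e](splitr e) mulrDl lerD ?s0P ?s1P.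
Qed.

(* Pitt's theorem: N disjoint humps, which may be chosen with nearly disjoint
   images, would map a vector of norm N^(1/q) to one of size N^(1/r). *)
Lemma pitt (e : R) : r < q -> 0 < e ->
  exists s0, forall s x, (s0 <= s)%N -> rnorm (T (lp_tail s x)) <= e * rnorm x.
Proof.
move=> rq e0; have lt1q : 1 < q by exact: le_lt_trans rq.
suff [s0 s0P] : exists s, forall x,
    rnorm (restr predT (T (lp_tail s x))) <= e * rnorm x.
  exists s0 => s x ss0; rewrite (tail_tail _ ss0).
  rewrite -[T _]restr_predT (le_trans (s0P _))//.
  by rewrite ler_wpM2l ?(ltW e0)// rnorm_restr.
apply: contrapT => /(gliding_hump e0) H.
have r0 : 0 < r by exact: (lt_le_trans ltr01).
have q0 : 0 < q by exact: (lt_le_trans ltr01).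
have [|N N0] := @powR_gap R q^-1 r^-1 (e / 4) (rnorm T + e / 8) _
  (divr_gt0 e0 (ltr0Sn R 3)).
  by rewrite ltf_pV2.
apply/negP; rewrite -leNgt.
have N0' : (0 : R) < N%:R by rewrite ltr0n.
have N1 : (1 : R) <= N%:R by rewrite ler1n.
(* Chosen after [N], so that N errors of size 2 d total e / 8, which is absorbed by N^(1/q) >= 1. *)
pose d := e / (16 * N%:R); have d0 : 0 < d by rewrite divr_gt0// mulr_gt0.
have dN : 2 * d * N%:R = e / 8 by rewrite /d; field; rewrite gt_eqF.
have d8 : 2 * d <= e / 8 by rewrite -dN ler_peMr// mulr_ge0// ltW.
have [m|a [x aP]] := @ex_chain _ (fun m x m' => [/\ (m <= m')%N, rnorm x <= 1,
    lp_mid m m' x = x, e / 2 <= rnorm (T x) &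
    rnorm (T x - lp_mid m m' (T x)) <= 2 * d]).
  have [s0 s0P] := op_tail_head_cvg m lt1q d0.
  (* The hump starts so late that its image nearly vanishes on [0,m); [m'] then cuts the tail of
     that image. *)
  pose s := maxn m s0; have [x [t [st x1 xE ex]]] := H s.
  have [t0 t0P] := rnorm_tail_cvg (T x) d0.
  pose m' := maxn t t0.
  have ms : (m <= s)%N by exact: leq_maxl.
  have tm' : (t <= m')%N by exact: leq_maxl.
  have mm' : (m <= m')%N by rewrite (leq_trans ms)// (leq_trans st).
  exists x, m'; split=> //.
  - rewrite -{1}xE restr_sub ?xE// => n; rewrite -!topredE/= => /andP[sn nt].
    by rewrite (leq_trans ms sn) (leq_trans nt tm').
  rewrite {1}(head_mid_tail (T x) mm') addrAC addrK.
  rewrite (le_trans (ler_rnormD _ _))// mulr_natl mulr2n lerD//; last first.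
    by rewrite t0P// leq_maxr.
  have -> : x = lp_tail s x.
    by rewrite -xE restr_sub// => n; rewrite -!topredE/= => /andP[].
  by rewrite (le_trans (s0P _ _ (leq_maxr _ _)))// ler_piMr// ltW.
have a_homo i : (a i <= a i.+1)%N by case: (aP i).
(* An image of norm at least e / 2 keeps e / 4 inside its block, as at most 2 d <= e / 8 lies
   outside. *)
have low := @rnorm_sum_blk_ge _ _ _ r1 a a_homo N (fun i => T (x i)) (e / 4)
  (2 * d).
apply: (@le_trans _ _ (rnorm (\sum_(i < N) T (x i)) + N%:R * (2 * d))).
  apply: low => [|i|i]; first by rewrite divr_ge0// ltW.
    have [_ _ _ ex dx] := aP i.
    have := ler_rnormD (lp_mid (a i) (a i.+1) (T (x i)))
      (T (x i) - lp_mid (a i) (a i.+1) (T (x i))).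
    by rewrite addrC subrK; lra.
  by case: (aP i).
rewrite -bop_sum [N%:R * _]mulrC dN mulrDl lerD//; last first.
  have Nq : 1 <= N%:R `^ q^-1.
    by rewrite -[leLHS](powRr0 N%:R) ler_powR// invr_ge0 ltW.
  by rewrite ler_peMr// divr_ge0// ltW.
rewrite (le_trans (le_rnorm_bop _ _))// ler_wpM2l ?rnorm_ge0//.
have xE i : x i = lp_mid (a i) (a i.+1) (x i) by case: (aP i).
under eq_bigr do rewrite xE; rewrite -[leRHS]mul1r.
by apply: rnorm_sum_blk_le => // i; rewrite -xE; case: (aP i).
Qed.

End GlidingHump.

(** * Infinite-dimensional subspaces *)

Section Subspaces.
Variables (R : realType) (k : scalars).
Local Notation K := (scalar_field R k).
Variable E : normedModType K.

Definition subspace_set (V : set E) :=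
  V 0 /\ forall (a : K) u v, V u -> V v -> V (a *: u + v).

Lemma submod_closed_set (V : set E) : submod_closed [in V] -> subspace_set V.
Proof.
move=> [V0 VP]; split; first exact: set_mem.
by move=> a u v Vu Vv; apply: set_mem; apply: VP; exact: mem_set.
Qed.

Lemma subspaceZ (V : set E) a u : subspace_set V -> V u -> V (a *: u).
Proof. by move=> [V0 VP] Vu; rewrite -[_ *: _]addr0; exact: VP. Qed.

Lemma subspace_sum (V : set E) n (u : 'I_n -> E) :
  subspace_set V -> (forall i, V (u i)) -> V (\sum_i u i).
Proof.
move=> [V0 VP] Vu; elim/big_ind : _ => // x y Vx Vy.
by rewrite -[x]scale1r; exact: VP.
Qed.

(** A kernel has codimension at most one: a v in V with f v nonzero completes a spanning family of
    the kernel to one of V. *)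
Lemma finite_dimensional_ker (V : set E) (f : E -> K) : subspace_set V ->
  (forall a u v, f (a *: u + v) = a * f u + f v) ->
  finite_dimensional [set x | V x /\ f x = 0]%classic -> finite_dimensional V.
Proof.
move=> [V0 VP] fL [n [e [eV eP]]].
have [Vf|] := pselect (forall x, V x -> f x = 0).
  exists n, e; split=> [i|x Vx]; first by case: (eV i).
  by apply: eP; split=> //; exact: Vf.
move=> /existsNP[v /not_implyP[Vv /eqP fv]].
exists n.+1, (fun i => if unlift ord0 i is Some j then e j else v); split.
  by move=> i; case: unliftP => [j _|_//]; case: (eV j).
move=> x Vx; have [|c cP] := eP (- (f x / f v) *: v + x).
  split; first exact: VP.
  by rewrite fL mulNr divfK// addNr.
exists (fun i => if unlift ord0 i is Some j then c j else f x / f v).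
rewrite big_ord_recl unlift_none; under eq_bigr do rewrite liftK.
by rewrite -cP addrA -scalerDl subrr scale0r add0r.
Qed.

Lemma infinite_dimensional_kers (V : set E) (f : nat -> E -> K) n :
  subspace_set V ->
  (forall i a u v, f i (a *: u + v) = a * f i u + f i v) ->
  ~ finite_dimensional V ->
  exists2 x, V x & x != 0 /\ forall i, (i < n)%N -> f i x = 0.
Proof.
move=> VS fL; elim: n => [|n IH] in V VS *.
  (* Without a nonzero vector, [V] would be spanned by the empty family. *)
  move=> Vinf; apply: contrapT => H; apply: Vinf.
  exists 0%N, (fun=> 0); split=> [[]//|x Vx]; exists (fun=> 0).
  rewrite big_ord0; apply: contrapT => /eqP x0; apply: H; by exists x.
move=> Vinf; have [|/(finite_dimensional_ker VS (fL n))//|x [Vx fx] [x0 xP]] :=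
    IH [set x | V x /\ f n x = 0]%classic.
  have [V0 VP] := VS; split.
    split=> //; have := fL n 0 0 0; rewrite scale0r addr0 mul0r add0r => f0.
    by have := fL n (-1) 0 0; rewrite scaler0 addr0 mulN1r addNr.
  move=> a u v [Vu fu] [Vv fv]; split; first exact: VP.
  by rewrite fL fu fv mulr0 addr0.
exists x => //; split=> // i; rewrite ltnS leq_eqVlt => /predU1P[->//|].
exact: xP.
Qed.

(** Continuity of the inverse at 0, with tolerance 1, gives a radius e. A unit vector of V whose
    image were shorter than e would be recovered by the inverse as a vector of norm less than 1. *)
Lemma iso_bounded_below (F : normedModType K) (S : bop E F) (V : set E) :
  subspace_set V -> iso_onto_range V S ->
  exists2 c : R, 0 < c & forall x, V x -> c * rnorm x <= rnorm (S x).
Proof.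
move=> VS [_ [G GK /subspace_continuousP Gc]]; have [V0 _] := VS.
have GS x : V x -> G (S x) = x by move=> Vx; apply: GK; exact: mem_set.
have := Gc (S 0) (ex_intro2 _ _ 0 V0 erefl).
rewrite /from_subspace GS// => /cvgrPdist_lt /(_ 1 ltr01).
rewrite near_withinE linear0 => /nbhs_normP[e /= e0 eP].
have eE : of_real k (modulus e) = e by rewrite -norm_modulus gtr0_norm.
exists (modulus e).
  rewrite lt_neqAle modulus_ge0 andbT eq_sym; apply/eqP => /modulus_eq0 e00.
  by rewrite e00 ltxx in e0.
move=> x Vx; have [->|x0] := eqVneq x 0.
  by rewrite rnorm0 mulr0 rnorm_ge0.
rewrite -ler_pdivlMr ?rnorm_gt0//.
pose u := of_real k (rnorm x)^-1 *: x.
have Vu : V u by exact: subspaceZ.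
rewrite leNgt; apply/negP => Sxe.
have : `|0 - S u| < e.
  rewrite sub0r normrN -of_real_rnorm -eE ltr_of_real.
  by rewrite bopZE rnormZ modulus_of_real ?invr_ge0 ?rnorm_ge0// mulrC.
move=> /eP /= /(_ (ex_intro2 _ _ u Vu erefl)); rewrite GS// sub0r normrN.
by rewrite -of_real_rnorm rnorm_scale_unit// of_real1 ltxx.
Qed.

End Subspaces.

(** The i^2 matrix entries of the corner are linear functionals, numbered by l = a i + b for row a
    and column b. Including all smaller corners makes the condition monotone in i. *)
Lemma zero_corner (R : realType) (k : scalars) (p q : R)
    (p1 : 1 <= p) (q1 : 1 <= q) (V : set (bop (lp k q1) (lp k p1))) i :
  subspace_set V -> ~ finite_dimensional V ->
  exists T, [/\ V T, rnorm T = 1 & forall s, (s <= i)%N -> forall x,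
    lp_head s (T (lp_head s x)) = 0].
Proof.
move=> VS Vinf; pose f l (T : bop (lp k q1) (lp k p1)) :=
  T (lp_unit (l %% i)%N) (l %/ i)%N.
have fL l a u v : f l (a *: u + v) = a * f l u + f l v.
  by rewrite /f bop_addE lpDE bop_scaleE lpZE.
have [T VT [T0 TP]] := infinite_dimensional_kers (i * i)%N VS fL Vinf.
have Tij a b : (a < i)%N -> (b < i)%N -> T (lp_unit b) a = 0.
  move=> ai bi; have i0 : (0 < i)%N by exact: leq_trans ai.
  have := TP (a * i + b)%N; rewrite /f modnMDl modn_small//.
  rewrite divnMDl// divn_small//.
  rewrite addn0; apply; apply: leq_trans (_ : a.+1 * i <= _)%N.
    by rewrite mulSn addnC ltn_add2r.
  by rewrite leq_mul2r ai orbT.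
exists (of_real k (rnorm T)^-1 *: T); split.
- exact: subspaceZ.
- exact: rnorm_scale_unit.
move=> s si x; apply: lp_ext => n; rewrite restrE lp0E; case: ltnP => // ns.
rewrite bop_scaleE lpZE head_sum bop_sum lp_sumE big1 ?mulr0// => j _.
by rewrite bopZE lpZE Tij ?mulr0// (leq_trans _ si).
Qed.

(** * Sums of almost disjoint operators *)

Section Closeness.
Variables (R : realType) (k : scalars).
Local Notation K := (scalar_field R k).

Definition close (V : normedModType K) (d : R) (u v : V) := rnorm (u - v) <= d.

Lemma close_trans (V : normedModType K) (v u w : V) c d :
  close c u v -> close d v w -> close (c + d) u w.
Proof.
move=> uv vw; rewrite /close -(subrK v u) -addrA.
by rewrite (le_trans (ler_rnormD _ _))// lerD.
Qed.

Lemma closeD (V : normedModType K) (u u' v v' : V) c d :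
  close c u u' -> close d v v' -> close (c + d) (u + v) (u' + v').
Proof.
move=> cu dv; rewrite /close opprD addrACA.
by rewrite (le_trans (ler_rnormD _ _))// lerD.
Qed.

Lemma close_le (V : normedModType K) (u v : V) c d :
  c <= d -> close c u v -> close d u v.
Proof. by move=> cd /le_trans; exact. Qed.

Lemma close_sum (V : normedModType K) N (u v : nat -> V) d :
  (forall i, (i < N)%N -> close d (u i) (v i)) ->
  close (N%:R * d) (\sum_(i < N) u i) (\sum_(i < N) v i).
Proof.
move=> uv; rewrite /close -sumrB (le_trans (ler_rnorm_sum _ _ _))//.
rewrite mulr_natl -[X in _ *+ X]card_ord -sumr_const; apply: ler_sum => i _.
exact: uv.
Qed.

Lemma close_bop (V W : normedModType K) (S : bop V W) (u v : V) d :
  close d u v -> close (rnorm S * d) (S u) (S v).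
Proof.
move=> uv; rewrite /close -linearB (le_trans (le_rnorm_bop _ _))//.
by rewrite ler_wpM2l ?rnorm_ge0.
Qed.

Lemma close_restr (p : R) (p1 : 1 <= p) P (u v : lp k p1) d :
  close d u v -> close d (restr P u) (restr P v).
Proof. by rewrite /close -linearB; apply: le_trans; exact: rnorm_restr. Qed.

Lemma close_rnorm (V : normedModType K) (u v : V) d :
  close d u v -> rnorm u <= rnorm v + d.
Proof.
move=> uv; rewrite -(subrK v u) addrC.
by rewrite (le_trans (ler_rnormD _ _))// lerD2l.
Qed.

Lemma close_sym (V : normedModType K) (u v : V) d : close d u v -> close d v u.
Proof. by rewrite /close -rnormN opprB. Qed.

End Closeness.

Section Steps.
Variables (R : realType) (k : scalars) (p q : R) (p1 : 1 <= p) (q1 : 1 <= q).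
Variables A B : bop (lp k p1) (lp k q1).
Local Notation bopT := (bop (lp k q1) (lp k p1)).

(* T is carried up to e by the square [0,t)^2 minus the corner [0,s)^2; the
   flags c and r say that the columns (resp. rows) below s are negligible as
   well, so that for c = r = true only the block [s,t)^2 is left.  Up to e, A
   maps [s,t) into [m,m') and B reaches [s,t) only from [m,m'). *)
Record step (c r : bool) (e : R) (m s t m' : nat) (T : bopT) : Prop := Step {
  step_ms : (m <= s)%N;
  step_st : (s <= t)%N;
  step_tm : (t <= m')%N;
  step_headA : forall x, rnorm (lp_head m (A (lp_tail s x))) <= e * rnorm x;
  step_tailA : forall x, rnorm (lp_tail m' (A (lp_head t x))) <= e * rnorm x;
  step_tailB : forall x, rnorm (lp_tail s (B (lp_head m x))) <= e * rnorm x;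
  step_headB : forall x, rnorm (lp_head t (B (lp_tail m' x))) <= e * rnorm x;
  step_Ttail : forall x, rnorm (T (lp_tail t x)) <= e * rnorm x;
  step_tailT : forall x, rnorm (lp_tail t (T x)) <= e * rnorm x;
  step_corner : forall x, lp_head s (T (lp_head s x)) = 0;
  step_col : c -> forall x, rnorm (T (lp_head s x)) <= e * rnorm x;
  step_row : r -> forall x, rnorm (lp_head s (T x)) <= e * rnorm x;
  step_norm : rnorm T = 1 }.

Section OneStep.
Variables (c r : bool) (e : R) (m s t m' : nat) (T : bopT).
Hypotheses (e0 : 0 <= e) (H : step c r e m s t m' T).
Local Notation mid := (lp_mid s t).
Local Notation blk := (lp_mid m m').

Let mm' : (m <= m')%N.
Proof.
by rewrite (leq_trans (step_ms H))// (leq_trans (step_st H))// (step_tm H).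
Qed.

Lemma blk_mid (l : R) (l1 : 1 <= l) (x : lp k l1) : blk (mid x) = mid x.
Proof.
rewrite restr_sub// => n; rewrite -!topredE/= => /andP[sn nt].
by rewrite (leq_trans (step_ms H) sn) (leq_trans nt (step_tm H)).
Qed.

Lemma mid_blk (l : R) (l1 : 1 <= l) (x : lp k l1) : mid (blk x) = mid x.
Proof.
rewrite restr_restr; apply: eq_restr => n /=; apply: andb_idr => /andP[sn nt].
by rewrite (leq_trans (step_ms H) sn) (leq_trans nt (step_tm H)).
Qed.

Lemma close_blk (l : R) (l1 : 1 <= l) (x : lp k l1) d :
  rnorm (lp_head m x) <= d -> rnorm (lp_tail m' x) <= d ->
  close (2 * d) x (blk x).
Proof.
move=> hx tx; rewrite /close {1}(head_mid_tail x mm') addrAC addrK.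
by rewrite mulr_natl mulr2n (le_trans (ler_rnormD _ _))// lerD.
Qed.

(** Cut x and T x at s and t. The corner is zero, three pieces are kept, and the factor 3 counts
    what is dropped: the tails of the images of head and middle, and the whole image of the tail. *)
Lemma step_closeT (d : R) x :
  rnorm x <= d ->
  close (3 * e * d) (T x)
    (mid (T (mid x)) + mid (T (lp_head s x)) + lp_head s (T (mid x))).
Proof.
move=> xd; have ed : e * rnorm x <= e * d by rewrite ler_wpM2l.
rewrite /close.
have E1 y : T y = lp_head s (T y) + mid (T y) + lp_tail t (T y).
  exact: head_mid_tail (step_st H).
rewrite {1}(head_mid_tail x (step_st H)) !linearD /=.
rewrite {1}(E1 (lp_head s x)) (step_corner H) add0r {1}(E1 (mid x)).
set a1 := mid (T (lp_head s x)); set a2 := lp_tail t _.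
set a3 := lp_head s (T (mid x)); set a4 := mid (T (mid x)).
set a5 := lp_tail t _.
set a6 := T _.
have -> : a1 + a2 + (a3 + a4 + a5) + a6 + (- a4 - a1 - a3) = a2 + a5 + a6.
  by apply: lp_ext => n; rewrite !(lpDE, lpNE); ring.
have h1 : rnorm a2 <= e * d.
  rewrite (le_trans (step_tailT H _))// (le_trans _ ed)// ler_wpM2l//.
  exact: rnorm_restr.
have h2 : rnorm a5 <= e * d.
  rewrite (le_trans (step_tailT H _))// (le_trans _ ed)// ler_wpM2l//.
  exact: rnorm_restr.
have h3 : rnorm a6 <= e * d by rewrite (le_trans (step_Ttail H _)).
have := ler_rnormD (a2 + a5) a6; have := ler_rnormD a2 a5; lra.
Qed.

Lemma step_closeA w d : rnorm w <= d ->
  close (2 * e * d) (A (mid w)) (blk (A (mid w))).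
Proof.
move=> wd; rewrite -mulrA; apply: close_blk.
  have -> : mid w = lp_tail s (mid w).
    by rewrite restr_sub// => n; rewrite -!topredE/= => /andP[].
  rewrite (le_trans (step_headA H _))// ler_wpM2l//.
  exact: le_trans (rnorm_restr _ _) wd.
have -> : mid w = lp_head t (mid w).
  by rewrite restr_sub// => n; rewrite -!topredE/= => /andP[].
rewrite (le_trans (step_tailA H _))// ler_wpM2l//.
exact: le_trans (rnorm_restr _ _) wd.
Qed.

Lemma step_closeB x : rnorm x <= 1 ->
  close (2 * e) (mid (B x)) (mid (B (blk x))).
Proof.
move=> x1; rewrite /close {1}(head_mid_tail x mm') !linearD/= addrAC addrK.
have ex : e * rnorm x <= e by rewrite ler_piMr.
rewrite mulr_natl mulr2n (le_trans (ler_rnormD _ _))// lerD//.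
  apply: le_trans ex; apply: le_trans (step_tailB H _).
  set y := B _; rewrite (_ : mid y = mid (lp_tail s y)) ?rnorm_restr//.
  rewrite restr_restr; apply: eq_restr => n /=.
  by apply/esym/andb_idr => /andP[].
apply: le_trans ex; apply: le_trans (step_headB H _).
set y := B _; rewrite (_ : mid y = mid (lp_head t y)) ?rnorm_restr//.
rewrite restr_restr; apply: eq_restr => n /=.
by apply/esym/andb_idr => /andP[].
Qed.

(** [z1], [z2], [z3] come from the block, column and row parts of T. The block part is localised on
    both sides. The column part is localised only in its output, so its bound does not see [blk x];
    the row part only in its input, so [z3] is not cut to a block. *)
Lemma step_decomp x (a b : R) : rnorm x <= 1 -> rnorm A <= a -> rnorm B <= b ->
  exists z1 z2 z3,
  [/\ close (e * (5 * (a + b + a * b))) (A (T (B x)))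
        (blk z1 + blk z2 + z3),
      rnorm (blk z1) <= a * b * rnorm (blk x),
      rnorm (blk z2) <= (if c then 0 else a * b) &
      rnorm z3 <= (if r then 0 else a * b * rnorm (blk x))].
Proof.
move=> x1 Aa Bb; have a0 : 0 <= a by exact: le_trans (rnorm_ge0 _) Aa.
have b0 : 0 <= b by exact: le_trans (rnorm_ge0 _) Bb.
have T1 z : rnorm (T z) <= rnorm z.
  by rewrite (le_trans (le_rnorm_bop _ _))// (step_norm H) mul1r.
have Az z d : rnorm z <= d -> rnorm (A z) <= a * d.
  move=> zd; rewrite (le_trans (le_rnorm_bop _ _))//.
  by rewrite ler_pM ?rnorm_ge0.
have Bz z d : rnorm z <= d -> rnorm (B z) <= b * d.
  move=> zd; rewrite (le_trans (le_rnorm_bop _ _))//.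
  by rewrite ler_pM ?rnorm_ge0.
have cA (u v : lp k p1) d : close d u v -> close (a * d) (A u) (A v).
  move=> uv; apply: close_le (close_bop A uv); rewrite ler_wpM2r//.
  exact: le_trans (rnorm_ge0 _) uv.
have cT (u v : lp k q1) d : close d u v -> close d (T u) (T v).
  by move=> /(close_bop T); rewrite (step_norm H) mul1r.
set y := B x; have yb : rnorm y <= b by rewrite -[b]mulr1 Bz.
pose w := mid (B (blk x)).
have yw : close (2 * e) (mid y) w by exact: step_closeB.
have wb : rnorm w <= b * rnorm (blk x).
  by rewrite (le_trans (rnorm_restr _ _))// Bz.
have wb' : rnorm w <= b.
  rewrite (le_trans wb)// ler_piMr//; exact: le_trans (rnorm_restr _ _) x1.
have c0 := cA _ _ _ (step_closeT yb); rewrite !linearD/= in c0.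
have d1 : close (a * (2 * e) + 2 * e * b) (A (mid (T (mid y))))
    (blk (A (mid (T w)))).
  apply: close_trans (step_closeA _); last by rewrite (le_trans (T1 _)).
  exact/cA/close_restr/cT.
have hb : rnorm (T (lp_head s y)) <= b.
  by rewrite (le_trans (T1 _))// (le_trans (rnorm_restr _ _)).
have [z2 [d2 z2b]] : exists z2, close (e * (2 * b + a * b))
    (A (mid (T (lp_head s y)))) (blk z2) /\
    rnorm (blk z2) <= (if c then 0 else a * b).
  have [cT'|cF] := boolP c; last first.
    exists (A (mid (T (lp_head s y)))); split.
      apply: close_le (step_closeA hb).
      have : 0 <= e * (a * b) by rewrite !mulr_ge0.
      by lra.
    rewrite (le_trans (rnorm_restr _ _))// Az// (le_trans (rnorm_restr _ _))//.
  exists 0; rewrite linear0 rnorm0; split=> //; rewrite /close subr0.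
  apply: le_trans (_ : a * (e * b) <= _); last first.
    by rewrite mulrCA ler_wpM2l// lerDr mulr_ge0.
  rewrite Az// (le_trans (rnorm_restr _ _))// (le_trans (step_col H cT' _))//.
  by rewrite ler_wpM2l.
have [z3 [d3 z3b]] : exists z3, close (e * (2 * a + a * b))
    (A (lp_head s (T (mid y)))) z3 /\
    rnorm z3 <= (if r then 0 else a * b * rnorm (blk x)).
  have [rT|rF] := boolP r; last first.
    exists (A (lp_head s (T w))); split.
      apply: (@close_le _ _ _ _ _ (a * (2 * e))); last exact/cA/close_restr/cT.
      have : 0 <= e * (a * b) by rewrite !mulr_ge0.
      by lra.
    rewrite -mulrA Az// (le_trans (rnorm_restr _ _))// (le_trans (T1 _))//.
  exists 0; rewrite rnorm0; split=> //; rewrite /close subr0.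
  apply: le_trans (_ : a * (e * b) <= _); last first.
    by rewrite mulrCA ler_wpM2l// lerDr mulr_ge0.
  rewrite Az// (le_trans (step_row H rT _))// ler_wpM2l//.
  exact: le_trans (rnorm_restr _ _) yb.
exists (A (mid (T w))), z2, z3; split=> //.
  (* The errors add up to e (4 a + 4 b + 5 a b). *)
  apply: close_le (close_trans c0 (closeD (closeD d1 d2) d3)).
  have : 0 <= e * a by rewrite mulr_ge0.
  have : 0 <= e * b by rewrite mulr_ge0.
  have : 0 <= e * (a * b) by rewrite !mulr_ge0.
  by lra.
rewrite (le_trans (rnorm_restr _ _))// -mulrA Az//.
by rewrite (le_trans (rnorm_restr _ _))// (le_trans (T1 _)).
Qed.

End OneStep.
End Steps.

Section SumOfSteps.
Variables (R : realType) (k : scalars) (p q : R) (p1 : 1 <= p) (q1 : 1 <= q).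
Variables A B : bop (lp k p1) (lp k q1).
Variables (c r : bool) (e : R) (a s t : nat -> nat).
Variable T : nat -> bop (lp k q1) (lp k p1).
Hypotheses (e0 : 0 <= e) (lt1p : 1 < p) (pq : p < q).
Hypothesis H : forall i, step A B c r e (a i) (s i) (t i) (a i.+1) (T i).
Variable N : nat.
Local Notation mid i := (lp_mid (s i) (t i)).
Local Notation blk i := (lp_mid (a i) (a i.+1)).
Local Notation S := (\sum_(i < N) T i).

Let a_homo i : (a i <= a i.+1)%N.
Proof.
have Hi := H i; rewrite (leq_trans (step_ms Hi))// (leq_trans (step_st Hi))//.
exact: step_tm Hi.
Qed.

(** Block parts are dominated blockwise by x, and column parts lie in disjoint blocks of l_q. Row
    parts may overlap, so only the triangle inequality applies, followed by Hoelder for the block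
    norms of x. *)
Lemma rnorm_mulop_sum_le :
  rnorm (mulop A B S) <=
  rnorm A * rnorm B * (1 + (if c then 0 else N%:R `^ q^-1)
                         + (if r then 0 else N%:R `^ (1 - p^-1)))
  + N%:R * (e * (5 * (rnorm A + rnorm B + rnorm A * rnorm B))).
Proof.
set K := rnorm A * rnorm B; have K0 : 0 <= K by rewrite mulr_ge0 ?rnorm_ge0.
have AB0 : 0 <= 5 * (rnorm A + rnorm B + K).
  by rewrite mulr_ge0 ?addr_ge0 ?rnorm_ge0.
have if_ge0 (b : bool) (v : R) : 0 <= v -> 0 <= if b then 0 else v by case: b.
apply: rnorm_bop_le => [|x x1].
  by rewrite ?(addr_ge0, mulr_ge0, if_ge0, powR_ge0, rnorm_ge0, ler0n).
have -> : mulop A B S x = \sum_(i < N) A (T i (B x)).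
  have -> : mulop A B S x = A (S (B x)) by [].
  by rewrite bop_sumE bop_sum.
have /choice[z zP] : forall i, exists z : lp k q1 * lp k q1 * lp k q1,
    [/\ close (e * (5 * (rnorm A + rnorm B + K))) (A (T i (B x)))
        (blk i z.1.1 + blk i z.1.2 + z.2),
      rnorm (blk i z.1.1) <= K * rnorm (blk i x),
      rnorm (blk i z.1.2) <= (if c then 0 else K) &
      rnorm z.2 <= (if r then 0 else K * rnorm (blk i x))].
  move=> i; have [z1 [z2 [z3 ?]]] := step_decomp e0 (H i) x1 (lexx _) (lexx _).
  by exists (z1, z2, z3).
have cz i : (i < N)%N -> close (e * (5 * (rnorm A + rnorm B + K)))
    (A (T i (B x))) (blk i (z i).1.1 + blk i (z i).1.2 + (z i).2).
  by case: (zP i).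
apply: le_trans (close_rnorm (close_sum cz)) _.
rewrite lerD2r !big_split/= mulrDr mulrDr mulr1.
rewrite (le_trans (ler_rnormD _ _))// lerD//.
  rewrite (le_trans (ler_rnormD _ _))// lerD//.
    have z1 i : rnorm (blk i (z i).1.1) <= K * rnorm (blk i x) by case: (zP i).
    exact: (rnorm_sum_blk_dominated _ a_homo (ltW pq) K0 x1 z1).
  have z2 i : rnorm (blk i (z i).1.2) <= (if c then 0 else K) by case: (zP i).
  rewrite (le_trans (rnorm_sum_blk_le a_homo N (if_ge0 c _ K0) z2))//.
  by case: (c); rewrite ?mul0r ?mulr0.
rewrite (le_trans (ler_rnorm_sum _ _ _))//.
apply: (@le_trans _ _ (\sum_(i < N) (if r then 0 else K) * rnorm (blk i x))).
  apply: ler_sum => i _; have [_ _ _] := zP i; case: (r) => //.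
  by rewrite mul0r.
rewrite -mulr_sumr; case: (r); rewrite ?mul0r ?mulr0// ler_wpM2l//.
exact: sum_rnorm_blk_le.
Qed.

Lemma step_close_mid i P y d :
  rnorm (restr P (T i (lp_head (s i) y))) <= d -> e * rnorm y <= d ->
  close (2 * d) (restr P (T i y)) (restr P (T i (mid i y))).
Proof.
move=> hy yd; rewrite /close {1}(head_mid_tail y (step_st (H i))).
rewrite !linearD/= addrAC addrK (le_trans (ler_rnormD _ _))//.
rewrite mulr_natl mulr2n lerD// (le_trans (rnorm_restr _ _))//.
by rewrite (le_trans (step_Ttail (H i) _)).
Qed.

Lemma step_close_blk i y : rnorm (lp_head (s i) (T i y)) <= e -> rnorm y <= 1 ->
  close (2 * e) (T i y) (blk i (T i y)).
Proof.
move=> hy y1; apply: (close_blk (H i)).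
  rewrite (le_trans _ hy)// rnorm_restr_sub// => n nm.
  exact: leq_trans nm (step_ms (H i)).
apply: (@le_trans _ _ (rnorm (lp_tail (t i) (T i y)))).
  by rewrite rnorm_restr_sub// => n; apply: leq_trans; exact: step_tm (H i).
by rewrite (le_trans (step_tailT (H i) _))// ler_piMr.
Qed.

(** Row j meets the first [s i] columns only inside the zero corner. *)
Lemma step_coord i j y : (j < s i)%N ->
  restr (pred1 j) (T i (lp_head (s i) y)) = 0.
Proof.
move=> js; have <- : restr (pred1 j) (lp_head (s i) (T i (lp_head (s i) y))) =
    restr (pred1 j) (T i (lp_head (s i) y)).
  rewrite restr_restr; apply: eq_restr => n /=.
  by apply: andb_idr => /eqP ->.
by rewrite (step_corner (H i)) linear0.
Qed.

(** The sum y of the disjoint [x i] has norm at most N^(1/q), and [T i] nearly sees only [x i] in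
    it: what lies before [s i] is excluded by the last hypothesis, what lies beyond [t i] by
    [step_Ttail]. So the left side is nearly S y on [P]. *)
Lemma rnorm_test (P : pred nat) (x : nat -> lp k q1) :
  (forall i, mid i (x i) = x i) -> (forall i, rnorm (x i) <= 1) ->
  (forall i y, rnorm (restr P (T i (lp_head (s i) y))) <= e * rnorm y) ->
  rnorm (restr P (\sum_(i < N) T i (x i))) <=
  (rnorm S + 2 * (N%:R * e)) * N%:R `^ q^-1.
Proof.
move=> xmid x1 TP.
have xblk i : blk i (x i) = x i by rewrite -(xmid i) (blk_mid (H i)).
pose y := \sum_(i < N) blk i (x i).
have y_le : rnorm y <= N%:R `^ q^-1.
  rewrite -[leRHS]mul1r; apply: rnorm_sum_blk_le => // i.
  by rewrite xblk.
have midy i : (i < N)%N -> mid i y = x i.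
  by move=> iN; rewrite -(mid_blk (H i)) blk_sum// xblk.
have Ty i : (i < N)%N ->
    close (2 * (e * rnorm y)) (restr P (T i (x i))) (restr P (T i y)).
  by move=> iN; rewrite -(midy i iN); apply/close_sym/step_close_mid.
have := close_rnorm (close_sum Ty); rewrite -!linear_sum/= => /le_trans; apply.
rewrite -bop_sumE [leRHS]mulrDl; apply: lerD.
  rewrite (le_trans (rnorm_restr _ _))// (le_trans (le_rnorm_bop _ _))//.
  by rewrite ler_wpM2l ?rnorm_ge0.
by rewrite mulrCA -!mulrA ler_wpM2l// ler_wpM2l ?ler0n// ler_wpM2l.
Qed.

Lemma rnorm_sum_ge_block : c -> r -> e <= 16^-1 ->
  2^-1 * N%:R `^ p^-1 <= (rnorm S + 4 * (N%:R * e)) * N%:R `^ q^-1.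
Proof.
move=> cT rT e16.
have /choice[x xP] : forall i, exists x, [/\ mid i x = x, rnorm x <= 1 &
    2^-1 <= rnorm (blk i (T i x))].
  (* Cutting the vector and then its image costs 2 e each, and 3/4 - 4/16 = 1/2. *)
  move=> i; have [||x x1 xT] := @rnorm_bop_gt _ _ _ _ (T i) (3 / 4).
  - by rewrite divr_ge0.
  - by rewrite (step_norm (H i)); lra.
  have ex : e * rnorm x <= e by rewrite ler_piMr.
  have mx1 : rnorm (mid i x) <= 1 by rewrite (le_trans (rnorm_restr _ _)).
  exists (mid i x); split=> //; first by rewrite restr_sub.
  have c1 : close (2 * e) (T i x) (T i (mid i x)).
    rewrite -(restr_predT (T i x)) -(restr_predT (T i (mid i x))).
    apply: step_close_mid => //; rewrite restr_predT.
    exact: le_trans (step_col (H i) cT _) ex.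
  have c2 : close (2 * e) (T i (mid i x)) (blk i (T i (mid i x))).
    apply: step_close_blk => //.
    by rewrite (le_trans (step_row (H i) rT _))// ler_piMr.
  by have := close_rnorm (close_trans c1 c2); lra.
have xb i : close (2 * e) (T i (x i)) (blk i (T i (x i))).
  have [_ xi1 _] := xP i; apply: step_close_blk => //.
  by rewrite (le_trans (step_row (H i) rT _))// ler_piMr.
apply: (@le_trans _ _ (rnorm (\sum_(i < N) T i (x i)) + N%:R * (2 * e))).
  apply: (@rnorm_sum_blk_ge _ _ _ p1 a a_homo N (fun i => T i (x i))) => //.
  by move=> i; case: (xP i).
have h2 : rnorm (\sum_(i < N) T i (x i)) <=
    (rnorm S + 2 * (N%:R * e)) * N%:R `^ q^-1.
  rewrite -(restr_predT (\sum_(i < N) _)).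
  apply: (@rnorm_test predT x) => [i|i|i y].
  - by case: (xP i).
  - by case: (xP i).
  by rewrite restr_predT (step_col (H i) cT).
have h3 : N%:R * e <= N%:R * e * N%:R `^ q^-1.
  have [->|N0] := eqVneq N 0%N; first by rewrite !mul0r.
  rewrite ler_peMr ?mulr_ge0// -[leLHS](powRr0 N%:R) ler_powR ?ler1n ?lt0n//.
  by rewrite invr_ge0 (le_trans ler01).
by lra.
Qed.

(** All operators are tested on the same unit vector. The zero corners push its images into nearly
    disjoint blocks of l_p, each keeping d - 2 e >= d / 2. *)
Lemma rnorm_sum_ge_col j d : 0 <= d -> e <= d / 4 -> (forall i, (j < s i)%N) ->
  (forall i, d <= rnorm (T i (lp_unit j))) ->
  d / 2 * N%:R `^ p^-1 <= rnorm S + 2 * (N%:R * e).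
Proof.
move=> d0 ed js dT.
have uE i : lp_unit j = lp_head (s i) (lp_unit j) :> lp k q1.
  apply: lp_ext => n; rewrite restrE lp_unitE; case: ltnP => //.
  by have [->|//] := eqVneq n j; rewrite leqNgt js.
have wb i : close (2 * e) (T i (lp_unit j)) (blk i (T i (lp_unit j))).
  apply: step_close_blk; last by rewrite rnorm_unit.
  by rewrite (uE i) (step_corner (H i)) rnorm0.
apply: (@le_trans _ _ (rnorm (\sum_(i < N) T i (lp_unit j)) + N%:R * (2 * e))).
  apply: (@rnorm_sum_blk_ge _ _ _ p1 a a_homo N
    (fun i => T i (lp_unit j))) => //.
    by rewrite divr_ge0.
  by move=> i; have := close_rnorm (wb i); have := dT i; lra.
rewrite -bop_sumE mulrCA lerD2r (le_trans (le_rnorm_bop _ _))//.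
by rewrite rnorm_unit mulr1.
Qed.

(** Disjoint test vectors, rotated by [ex_phase], pile up at coordinate j of the image; moving each
    one into [s i, t i) costs 2 e <= d / 2. *)
Lemma rnorm_sum_ge_row j d : 0 <= d -> e <= d / 4 -> (forall i, (j < s i)%N) ->
  (forall i, exists2 x, rnorm x <= 1 & d <= modulus (T i x j)) ->
  d / 2 * N%:R <= (rnorm S + 2 * (N%:R * e)) * N%:R `^ q^-1.
Proof.
move=> d0 ed js dT.
have /choice[x xP] : forall i, exists x, [/\ mid i x = x, rnorm x <= 1,
    T i x j = of_real k (modulus (T i x j)) & d / 2 <= modulus (T i x j)].
  move=> i; have [x x1 xd] := dT i.
  have [u u1 ux] := ex_phase (T i (mid i x) j).
  exists (u *: mid i x); split.
  - by rewrite linearZ/= restr_sub.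
  - by rewrite rnormZ u1 mul1r (le_trans (rnorm_restr _ _)).
  - by rewrite bopZE lpZE modulusM u1 mul1r.
  rewrite bopZE lpZE modulusM u1 mul1r.
  have ex : e * rnorm x <= e by rewrite ler_piMr.
  have := @step_close_mid i (pred1 j) x e; rewrite step_coord// rnorm0.
  by move=> /(_ e0 ex)/close_rnorm; rewrite !rnorm_single; lra.
have xmid i : mid i (x i) = x i by case: (xP i).
have x1 i : rnorm (x i) <= 1 by case: (xP i).
have := @rnorm_test (pred1 j) x xmid x1; set M := (X in _ -> _ <= X).
have TP i y : rnorm (restr (pred1 j) (T i (lp_head (s i) y))) <= e * rnorm y.
  by rewrite step_coord// rnorm0 mulr_ge0 ?rnorm_ge0.
move=> /(_ TP); apply: le_trans; rewrite rnorm_single lp_sumE.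
under [in leRHS]eq_bigr => i _ do (have [_ _ -> _] := xP i).
rewrite -of_real_sum modulus_of_real ?sumr_ge0// => [|i _]; last first.
  exact: modulus_ge0.
rewrite mulr_natr -[X in _ *+ X]card_ord -sumr_const; apply: ler_sum => i _.
by case: (xP i).
Qed.

End SumOfSteps.

(** * Choice of the operators *)

(** Decreasing nonempty sets play the role of a sequence, so passing to a subsequence means
    shrinking them. If some [Q j d] recurs in every [F i], keep the elements having it; otherwise
    each [Q j d] eventually disappears and [F] itself will do. *)
Lemma subfamily_dichotomy (R : realType) (X : Type) (F : nat -> set X)
    (Q : nat -> R -> X -> Prop) :
  (forall i, exists x, F i x) ->
  (forall i j x, (i <= j)%N -> F j x -> F i x) ->
  exists F' : nat -> set X,
  [/\ forall i, exists x, F' i x,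
      forall i j x, (i <= j)%N -> F' j x -> F' i x,
      forall i x, F' i x -> F i x &
      (exists j d, 0 < d /\ forall i x, F' i x -> Q j d x) \/
      (forall j d, 0 < d -> exists i, forall x, F' i x -> ~ Q j d x)].
Proof.
move=> Fne Fdec.
have [[j [d [d0 jd]]]|H] := pselect (exists j d, 0 < d /\
    forall i, exists x, F i x /\ Q j d x).
  exists (fun i x => F i x /\ Q j d x); split=> //.
  - by move=> i l x il [Fx Qx]; split=> //; exact: Fdec Fx.
  - by move=> i x [].
  by left; exists j, d; split=> // i x [].
exists F; split=> //; right => j d d0; apply: contrapT => Hi; apply: H.
exists j, d; split=> // i; apply: contrapT => Hx; apply: Hi.
by exists i => x Fx Qx; apply: Hx; exists x.
Qed.

Section Families.
Variables (R : realType) (k : scalars) (p q : R) (p1 : 1 <= p) (q1 : 1 <= q).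
Local Notation bopT := (bop (lp k q1) (lp k p1)).
Variable F : nat -> set bopT.
Hypothesis Fdec : forall i j T, (i <= j)%N -> F j T -> F i T.

Let uniform (G : nat -> R -> bopT -> Prop) s d :
  (forall j, exists i, forall T, F i T -> G j d T) ->
  exists i, forall T, F i T -> forall j, (j < s)%N -> G j d T.
Proof.
move=> H; elim: s => [|s [i iP]]; first by exists 0%N.
have [l lP] := H s; exists (maxn i l) => T FT j.
rewrite ltnS leq_eqVlt => /predU1P[->|js].
  by apply: lP; exact: Fdec (leq_maxr _ _) FT.
by apply: iP => //; exact: Fdec (leq_maxl _ _) FT.
Qed.

Let ratio_le s (e : R) : 0 < e -> s%:R * (e / s.+1%:R) <= e.
Proof.
move=> e0; rewrite mulrCA ler_piMr ?(ltW e0)// ler_pdivrMr ?ltr0n// mul1r.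
by rewrite ler_nat.
Qed.

Lemma null_columns s (e : R) : 0 < e ->
  (forall j d, 0 < d -> exists i, forall T, F i T ->
     ~ d <= rnorm (T (lp_unit j))) ->
  exists i, forall T, F i T -> forall x, rnorm (T (lp_head s x)) <= e * rnorm x.
Proof.
(* Summing over s columns costs a factor s; dividing by s + 1 also covers s = 0. *)
move=> e0 H; have d0 : 0 < e / s.+1%:R by rewrite divr_gt0.
have [i iP] := @uniform (fun j d T => ~ d <= rnorm (T (lp_unit j))) s _
  (fun j => H j _ d0).
exists i => T FT x; have := @linear_head_le _ _ _ q1 _ T s x (e / s.+1%:R).
move=> /(_ _)/le_trans; apply; last first.
  by rewrite ler_wpM2r ?rnorm_ge0// ratio_le.
by move=> j js; have /negP := iP T FT j js; rewrite -ltNge => /ltW.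
Qed.

Lemma null_rows s (e : R) : 0 < e ->
  (forall j d, 0 < d -> exists i, forall T, F i T ->
     ~ exists2 x, rnorm x <= 1 & d <= modulus (T x j)) ->
  exists i, forall T, F i T -> forall x, rnorm (lp_head s (T x)) <= e * rnorm x.
Proof.
move=> e0 H; have d0 : 0 < e / s.+1%:R by rewrite divr_gt0.
have [i iP] := @uniform (fun j d T =>
  ~ exists2 x, rnorm x <= 1 & d <= modulus (T x j)) s _ (fun j => H j _ d0).
exists i => T FT x; rewrite (le_trans (rnorm_head_le _ _))//.
apply: (@le_trans _ _ (\sum_(j < s) e / s.+1%:R * rnorm x)); last first.
  rewrite sumr_const card_ord -[leLHS]mulr_natl mulrA.
  by rewrite ler_wpM2r ?rnorm_ge0// ratio_le.
apply: ler_sum => j _; have [->|x0] := eqVneq x 0.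
  by rewrite linear0 modulus0 rnorm0 mulr0.
rewrite -ler_pdivrMr ?rnorm_gt0// leNgt; apply/negP => Hlt.
apply: (iP T FT j (ltn_ord j)); exists (of_real k (rnorm x)^-1 *: x).
  by rewrite rnorm_scale_unit.
rewrite bopZE lpZE modulusM modulus_of_real ?invr_ge0 ?rnorm_ge0//.
by rewrite [leRHS]mulrC ltW.
Qed.

(** The order of choices matters: s depends on m, [A] and [B] only, T is taken far enough in the
    family for this s, t depends on T, and m' on t. [J] keeps s beyond the fixed column and row. *)
Lemma step_exists (A B : bop (lp k p1) (lp k q1)) (c r : bool) J m (e : R) :
  1 < p -> p < q -> 0 < e ->
  (forall i, exists T, F i T) ->
  (forall i T, F i T -> rnorm T = 1 /\
    forall s, (s <= i)%N -> forall x, lp_head s (T (lp_head s x)) = 0) ->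
  (c -> forall j d, 0 < d -> exists i, forall T, F i T ->
    ~ d <= rnorm (T (lp_unit j))) ->
  (r -> forall j d, 0 < d -> exists i, forall T, F i T ->
    ~ exists2 x, rnorm x <= 1 & d <= modulus (T x j)) ->
  exists (u : nat * nat * bopT) m', [/\ step A B c r e m u.1.1 u.1.2 m' u.2,
    (J <= u.1.1)%N & F 0%N u.2].
Proof.
move=> lt1p pq e0 Fne F1 colH rowH.
have e20 : 0 < e / 2 by rewrite divr_gt0.
have [s1 s1P] := op_tail_head_cvg A m lt1p e0.
have [s2 s2P] := op_head_tail_cvg B m e0.
pose s := maxn (maxn m J) (maxn s1 s2).
have [/andP[ms Js] /andP[s1s s2s]] :
    (m <= s)%N && (J <= s)%N /\ (s1 <= s)%N && (s2 <= s)%N.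
  by rewrite -!geq_max leq_maxl leq_maxr.
have [ic icP] : exists i, c -> forall T, F i T -> forall x,
    rnorm (T (lp_head s x)) <= e * rnorm x.
  have [cT|_] := boolP c; last by exists 0%N.
  by have [i iP] := null_columns s e0 (colH cT); exists i.
have [ir irP] : exists i, r -> forall T, F i T -> forall x,
    rnorm (lp_head s (T x)) <= e * rnorm x.
  have [rT|_] := boolP r; last by exists 0%N.
  by have [i iP] := null_rows s e0 (rowH rT); exists i.
have [T FT] := Fne (maxn s (maxn ic ir)).
have [t1 t1P] := pitt T pq e0.
have [t2 t2P] := pitt T pq e20.
have [t3 t3P] := op_head_tail_cvg T t2 e20.
pose t := maxn (maxn s t1) (maxn t2 t3).
have [/andP[st t1t] /andP[t2t t3t]] :
    (s <= t)%N && (t1 <= t)%N /\ (t2 <= t)%N && (t3 <= t)%N.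
  by rewrite -!geq_max leq_maxl leq_maxr.
have [m1 m1P] := op_head_tail_cvg A t e0.
have [m2 m2P] := op_tail_head_cvg B t lt1p e0.
pose m' := maxn t (maxn m1 m2).
have [tm' /andP[m1m' m2m']] : (t <= m')%N /\ (m1 <= m')%N && (m2 <= m')%N.
  by rewrite -geq_max leq_maxl leq_maxr.
have [Tn Tc] := F1 _ _ FT.
exists (s, t, T), m'; split=> //=; last exact: Fdec FT.
split=> //.
- by move=> x; exact: s1P.
- by move=> x; exact: m1P.
- by move=> x; exact: s2P.
- by move=> x; exact: m2P.
- by move=> x; exact: t1P.
(* Uniformly small tails in the range: Pitt's theorem disposes of the input beyond [t2], and
   finitely many unit vectors span the rest. *)
- move=> x; rewrite {1}(head_tail t2 x) !linearD/=.
  rewrite (le_trans (ler_rnormD _ _))// [e in leRHS]splitr mulrDl lerD//.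
    exact: t3P.
  by rewrite (le_trans (rnorm_restr _ _))// t2P.
- by apply: Tc; exact: leq_maxl.
- move=> cT; apply: icP => //; apply: Fdec FT.
  by rewrite !leq_max leqnn orbT.
- move=> rT; apply: irP => //; apply: Fdec FT.
  by rewrite !leq_max leqnn !orbT.
Qed.

End Families.

(** * Comparison of the growth rates *)

Lemma powR_split (R : realType) (x u v w : R) : 0 < x -> u = v + w ->
  x `^ u = x `^ v * x `^ w.
Proof. by move=> x0 ->; rewrite powRD// (gt_eqF x0) implybT. Qed.

Theorem theorem5p5 (R : realType) (k : scalars) (p q : R)
    (p1 : 1 < p) (q1 : 1 < q) (pq : p < q)
    (A B : bop (lp k (ltW p1)) (lp k (ltW q1))) :
  strictly_singular
    (mulop A B : bop (bop (lp k (ltW q1)) (lp k (ltW p1)))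
                     (bop (lp k (ltW p1)) (lp k (ltW q1)))).
Proof.
move=> V /submod_closed_set VS Vinf /(iso_bounded_below VS)[c c0 cP].
pose F0 i : set (bop (lp k (ltW q1)) (lp k (ltW p1))) := fun T =>
  [/\ V T, rnorm T = 1 & forall s, (s <= i)%N -> forall x,
    lp_head s (T (lp_head s x)) = 0].
have F0ne i : exists T, F0 i T by have := zero_corner i VS Vinf; exact.
have F0dec i j T : (i <= j)%N -> F0 j T -> F0 i T.
  by move=> ij [VT T1 TP]; split=> // s si; apply: TP; exact: leq_trans ij.
have [F1 [F1ne F1dec F10 F1col]] := subfamily_dichotomy
  (fun j d (T : bop (lp k (ltW q1)) (lp k (ltW p1))) =>
     d <= rnorm (T (lp_unit j))) F0ne F0dec.
have [F [Fne Fdec F_F1 Frow]] := subfamily_dichotomy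
  (fun j d (T : bop (lp k (ltW q1)) (lp k (ltW p1))) =>
     exists2 x, rnorm x <= 1 & d <= modulus (T x j)) F1ne F1dec.
(* The flag is true if the columns are negligible; then the index 0 and the size 1 are dummies that
   let [d] and [J] be defined uniformly. *)
have [cf [jc [dc [dc0 colN colP]]]] : exists (b : bool) j d, [/\ 0 < d,
    b -> forall j d, 0 < d -> exists i, forall T, F i T ->
      ~ d <= rnorm (T (lp_unit j)) &
    ~~ b -> forall i T, F i T -> d <= rnorm (T (lp_unit j))].
  case: F1col => [[j [d [d0 jP]]]|H].
    by exists false, j, d; split=> // _ i T /F_F1 /jP.
  exists true, 0%N, 1; split=> // _ j d d0; have [i iP] := H j d d0.
  by exists i => T /F_F1 /iP.
have [rf [jr [dr [dr0 rowN rowP]]]] : exists (b : bool) j d, [/\ 0 < d,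
    b -> forall j d, 0 < d -> exists i, forall T, F i T ->
      ~ exists2 x, rnorm x <= 1 & d <= modulus (T x j) &
    ~~ b -> forall i T, F i T ->
      exists2 x, rnorm x <= 1 & d <= modulus (T x j)].
  case: Frow => [[j [d [d0 jP]]]|H].
    by exists false, j, d; split=> // _ i T /jP.
  by exists true, 0%N, 1; split.
pose d := Order.min 4^-1 (Order.min dc dr).
have d0 : 0 < d by rewrite !lt_min invr_gt0 ltr0n dc0 dr0.
have d4 : d <= 4^-1 by rewrite ge_min lexx.
have ddc : d <= dc by rewrite !ge_min lexx !orbT.
have ddr : d <= dr by rewrite !ge_min lexx !orbT.
have p0 : 0 < p by exact: (lt_trans ltr01 p1).
have q0 : 0 < q by exact: (lt_trans ltr01 q1).
pose theta := p^-1 - q^-1.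
have th0 : 0 < theta by rewrite subr_gt0 ltf_pV2.
set K := rnorm A * rnorm B; have K0 : 0 <= K by rewrite mulr_ge0 ?rnorm_ge0.
set L := 5 * (rnorm A + rnorm B + K).
have L0 : 0 <= L by rewrite mulr_ge0 ?addr_ge0 ?rnorm_ge0.
(* 3 K serves the summands 1, X and Y of the upper bound for |ASB|, and L its error term. *)
have [N N0 NC] := powR_unbounded ((3 * K + L) / (d / 4 * c)) th0.
have N0' : (0 : R) < N%:R by rewrite ltr0n.
have N1 : (1 : R) <= N%:R by rewrite ler1n.
pose e := d / (16 * N%:R); have e0 : 0 < e by rewrite divr_gt0// mulr_gt0.
have Ne : N%:R * e = d / 16 by rewrite /e; field; rewrite gt_eqF.
have ed : e <= d / 16 by rewrite -Ne ler_peMl// ltW.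
have ed4 : e <= d / 4 by clear - ed d0; lra.
have e16 : e <= 16^-1 by clear - ed d4; lra.
have d16 : d / 16 <= 1 by clear - d4; lra.
have [m|a [u uP]] := @ex_chain _ (fun m u m' =>
    [/\ step A B cf rf e m u.1.1 u.1.2 m' u.2,
      ((maxn jc jr).+1 <= u.1.1)%N & F 0%N u.2]).
  apply: (step_exists Fdec) => // i T /F_F1/F10[_ T1 TP]; split=> //.
have H i : step A B cf rf e (a i) (u i).1.1 (u i).1.2 (a i.+1) (u i).2.
  by case: (uP i).
have Fu i : F 0%N (u i).2 by case: (uP i).
have js i : (jc < (u i).1.1)%N /\ (jr < (u i).1.1)%N.
  have [_ sJ _] := uP i.
  by split; apply: leq_trans sJ; rewrite ltnS ?leq_maxl ?leq_maxr.
pose S := \sum_(i < N) (u i).2.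
have VT : V S.
  by apply: subspace_sum => // i; have [] := F10 _ _ (F_F1 _ _ (Fu i)).
have up := le_trans (cP _ VT) (rnorm_mulop_sum_le (ltW e0) p1 pq H N).
rewrite -/K -/L -/S mulrA Ne in up; set M := rnorm S in up.
set X := (if cf then _ else _) in up; set Y := (if rf then _ else _) in up.
have pow_ge1 (v : R) : 0 <= v -> 1 <= N%:R `^ v.
  by move=> v0; have := ler_powR N1 v0; rewrite powRr0.
set Z := N%:R `^ theta in NC.
have Z1 : 1 <= Z by rewrite pow_ge1// ltW.
have pE : N%:R `^ p^-1 = N%:R `^ q^-1 * Z.
  by apply: powR_split => //; rewrite addrC subrK.
have qE : N%:R `^ (1 - q^-1) = N%:R `^ (1 - p^-1) * Z.
  by apply: powR_split => //; rewrite addrA subrK.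
have NE : N%:R = N%:R `^ (1 - q^-1) * N%:R `^ q^-1.
  by rewrite -(@powR_split _ _ 1) ?powRr1 ?ler0n// subrK.
have Q1 : 1 <= N%:R `^ q^-1 by rewrite pow_ge1// invr_ge0 ltW.
have P1 : 1 <= N%:R `^ (1 - p^-1).
  by rewrite pow_ge1// subr_ge0 invf_le1// ltW.
have Q0 : 0 < N%:R `^ q^-1 by rewrite (lt_le_trans ltr01).
(* Each of the summands 1, X, Y, multiplied by d/4 N^theta, is at most |S|: all three cases have the
   same rate. *)
have hX : X * (d / 4 * Z) <= M.
  rewrite /X; have [_|cF] := boolP cf; first by rewrite mul0r rnorm_ge0.
  have low := rnorm_sum_ge_col (ltW e0) H N (j := jc) (ltW d0) ed4
    (fun i => (js i).1) (fun i => le_trans ddc (colP cF _ _ (Fu i))).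
  rewrite -/S -/M Ne pE in low.
  have dQZ : d <= d * (N%:R `^ q^-1 * Z).
    by rewrite ler_peMr ?(ltW d0)// -pE pow_ge1// invr_ge0 ltW.
  by clear - low dQZ d0; lra.
have hY : Y * (d / 4 * Z) <= M.
  rewrite /Y; have [_|rF] := boolP rf; first by rewrite mul0r rnorm_ge0.
  have rd i : exists2 x, rnorm x <= 1 & d <= modulus ((u i).2 x jr).
    by have [x x1 xd] := rowP rF _ _ (Fu i); exists x => //; exact: le_trans xd.
  have := rnorm_sum_ge_row (ltW e0) H N (j := jr) (ltW d0) ed4
    (fun i => (js i).2) rd.
  rewrite -/S -/M Ne [X in _ * X <= _]NE [leLHS]mulrA ler_pM2r// qE => low.
  have dPZ : d <= d * (N%:R `^ (1 - p^-1) * Z).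
    by rewrite ler_peMr ?(ltW d0)// mulr_ege1.
  by clear - low dPZ d0; lra.
have W0 : 0 < d / 4 * Z.
  by rewrite mulr_gt0 ?divr_gt0// (lt_le_trans ltr01).
(* A part that is not negligible has X >= 1 or Y >= 1 and reduces this to [hX] or [hY]; only pure
   blocks need their own test. *)
have hZ : d / 4 * Z <= M.
  have [cT|cF] := boolP cf; last first.
    by apply: le_trans hX; rewrite /X (negbTE cF) ler_peMl// ltW.
  have [rT|rF] := boolP rf; last first.
    by apply: le_trans hY; rewrite /Y (negbTE rF) ler_peMl// ltW.
  have := rnorm_sum_ge_block (ltW e0) H N cT rT e16.
  rewrite -/S -/M Ne pE (mulrC _ Z) [leLHS]mulrA ler_pM2r// => low.
  have dZ : d * Z <= 4^-1 * Z by rewrite ler_wpM2r// (le_trans ler01).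
  by clear - low dZ d4 Z1; lra.
have M0 : 0 < M by exact: lt_le_trans hZ.
move: NC; rewrite ltr_pdivrMr ?mulr_gt0 ?divr_gt0// -(ltr_pM2r M0) => NC.
(* Multiplied by d/4 Z, the upper bound becomes c (d/4 Z) M <= (3 K + L) M, against the choice of
   [N]. *)
have b3 := ler_wpM2l (ltW W0) up.
have b1 : K * (d / 4 * Z + X * (d / 4 * Z) + Y * (d / 4 * Z)) <= K * (3 * M).
  by rewrite ler_wpM2l//; clear - hX hY hZ; lra.
have b2 : d / 16 * (L * (d / 4 * Z)) <= L * M.
  have LW : 0 <= L * (d / 4 * Z) by rewrite mulr_ge0// ltW.
  by rewrite (le_trans (ler_wpM2r LW d16))// mul1r ler_wpM2l.
by clear - NC b1 b2 b3; lra.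
Qed.
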